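(* Let $\mathbb{F}$ be an infinite field, let $I,J,K$ be finite sets and $\Lambda\subseteq I\times J\times K$ nonempty. If $P$ is a probability distribution on $\Lambda$ and $a,b,c\ge0$ satisfy $a\le H(I)_P$, $b\le H(J)_P$, $c\le H(K)_P$, $a+b\le H(IJ)_P$, $a+c\le H(IK)_P$, $b+c\le H(JK)_P$, $a+b+c\le H(IJK)_P$, then $$\omega_s(a,b,c)\le\log\underset{\sim}{R}_s(\langle\Lambda\rangle)\le\log\underline{R}_s(\langle\Lambda\rangle)\le\log R_s(\langle\Lambda\rangle).$$ Consequently, $$\omega_s\le3\,\frac{\log R_s(\langle\Lambda\rangle)}{\log|\Lambda|}.$$
   Context: Logarithms are base 2. A tensor over $\mathbb{F}$ is a trilinear form $T=\sum t_{a,b,c}x_ay_bz_c$ with variables indexed by finite sets; its support is $\{(a,b,c):t_{a,b,c}\ne0\}$; its rank $R(T)$ is the minimal number of products of three linear forms (one in each set of variables) summing to $T$; its border rank $\underline{R}(T)$ is the smallest $r$ with $T$ in the closure of the tensors of rank $\le r$ (over the algebraic closure). For a support $\Phi$, $R_s(\Phi)=\min\{R(T):\operatorname{supp}T=\Phi\}$ and $\underline{R}_s(\Phi)=\min\{\underline{R}(T):\operatorname{supp}T=\Phi\}$; with $\Phi^n$ the $n$-fold product of supports (regrouping factors), the asymptotic support rank is $\underset{\sim}{R}_s(\Phi)=\lim_n R_s(\Phi^n)^{1/n}=\inf_n R_s(\Phi^n)^{1/n}=\lim_n\underline{R}_s(\Phi^n)^{1/n}$. For $\Lambda\subseteq I\times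 J\times K$, $\langle\Lambda\rangle=\{((i,j),(j,k),(k,i)):(i,j,k)\in\Lambda\}$, the support of $\sum_{(i,j,k)\in\Lambda}x_{i,j}y_{j,k}z_{k,i}$. The matrix multiplication tensor is $\langle l,m,n\rangle=\sum_{i\le l,j\le m,k\le n}x_{i,j}y_{j,k}z_{k,i}$. Define $\omega_s(a,b,c)=\lim_{n\to\infty}\frac1n\log R_s(\operatorname{supp}\langle\lfloor2^{an}\rfloor,\lfloor2^{bn}\rfloor,\lfloor2^{cn}\rfloor\rangle)$ and $\omega_s=\omega_s(1,1,1)=\log\underset{\sim}{R}_s(\operatorname{supp}\langle2,2,2\rangle)$ (the support rank exponent of matrix multiplication). For a probability distribution $P$ on $\Lambda$, $H(I)_P$, $H(IJ)_P$, etc. are the Shannon entropies of the marginals of $P$ on $I$, $I\times J$, etc., and $H(IJK)_P=H(P)$. *)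

(* Defs.v *)
From HB Require Import structures.
From mathcomp Require Import all_boot all_order all_algebra.
From mathcomp Require Import all_classical all_reals all_analysis.
From mathcomp Require mpoly.

Set Implicit Arguments.
Unset Strict Implicit.
Unset Printing Implicit Defensive.

Import Order.TTheory GRing.Theory Num.Theory.
Import numFieldNormedType.Exports.
Local Open Scope ring_scope.

(* A tensor T = sum t_{a,b,c} x_a y_b z_c with variables indexed by the finite
   sets X, Y, Z is represented by its coefficient function. *)
Definition support (F : fieldType) (X Y Z : finType) (T : X * Y * Z -> F)
  : {set X * Y * Z} := [set t | T t != 0].

Definition rank_le (F : pzRingType) (X Y Z : finType) (T : X * Y * Z -> F)
  (r : nat) : Prop :=
  exists (u : 'I_r -> X -> F) (v : 'I_r -> Y -> F) (w : 'I_r -> Z -> F),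
    forall t : X * Y * Z, T t = \sum_(l < r) u l t.1.1 * v l t.1.2 * w l t.2.

(* Border rank <= r: T lies in the Zariski closure of the tensors of rank <= r
   over an algebraic closure of F.  Zariski closure membership is written out:
   every polynomial (in the #|X*Y*Z| coordinates) vanishing on all tensors of
   rank <= r vanishes at T.  We require this for every algebraically closed
   field L containing F (via phi). *)
Definition border_rank_le (F : fieldType) (X Y Z : finType)
  (T : X * Y * Z -> F) (r : nat) : Prop :=
  forall (L : closedFieldType) (phi : {rmorphism F -> L})
         (p : mpoly.mpoly #|{: X * Y * Z}| L),
    (forall S : X * Y * Z -> L, rank_le S r ->
        mpoly.meval (fun i => S (enum_val i)) p = 0) ->
    mpoly.meval (fun i => phi (T (enum_val i))) p = 0.

Lemma rank_le_exists (F : pzRingType) (X Y Z : finType) (T : X * Y * Z -> F) :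
  rank_le T #|{: X * Y * Z}|.
Proof.
exists (fun l x => T (enum_val l) * (x == (enum_val l).1.1)%:R).
exists (fun l y => (y == (enum_val l).1.2)%:R).
exists (fun l z => (z == (enum_val l).2)%:R).
move=> t.
rewrite (bigD1 (enum_rank t)) //= enum_rankK !eqxx !mulr1 big1 ?addr0 // => l.
move=> /eqP Hl.
have Hne : enum_val l != t.
  by apply/eqP => E; apply: Hl; rewrite -E enum_valK.
case: (enum_val l) Hne => [[a b] c]; case: t {Hl} => [[x y] z] /=.
rewrite !xpair_eqE => H.
case: eqP => [?|_]; last by rewrite mulr0 !mul0r.
case: eqP => [?|_]; last by rewrite mulr0 mul0r.
case: eqP => [?|_]; last by rewrite mulr0.
subst; by rewrite !eqxx in H.
Qed.

Lemma rank_le_border (F : fieldType) (X Y Z : finType) (T : X * Y * Z -> F) r :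
  rank_le T r -> border_rank_le T r.
Proof.
move=> [u [v [w H]]] L phi p Hp; apply: (Hp (fun t => phi (T t))).
exists (fun l x => phi (u l x)), (fun l y => phi (v l y)), (fun l z => phi (w l z)).
by move=> t; rewrite H rmorph_sum; apply: eq_bigr => l _; rewrite !rmorphM.
Qed.

Lemma ind_support (F : fieldType) (X Y Z : finType) (Phi : {set X * Y * Z}) :
  support (fun t => ((t \in Phi)%:R : F)) = Phi.
Proof.
by apply/setP => t; rewrite inE; case: (t \in Phi); rewrite ?oner_neq0 ?eqxx.
Qed.

Definition Rs_pred (F : fieldType) (X Y Z : finType) (Phi : {set X * Y * Z})
  (r : nat) : bool :=
  `[< exists T : X * Y * Z -> F, support T = Phi /\ rank_le T r >].

Definition bRs_pred (F : fieldType) (X Y Z : finType) (Phi : {set X * Y * Z})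
  (r : nat) : bool :=
  `[< exists T : X * Y * Z -> F, support T = Phi /\ border_rank_le T r >].

Lemma Rs_ex (F : fieldType) (X Y Z : finType) (Phi : {set X * Y * Z}) :
  exists r, Rs_pred F Phi r.
Proof.
exists #|{: X * Y * Z}|; apply/asboolP.
by exists (fun t => (t \in Phi)%:R); split;
  [exact: ind_support | exact: rank_le_exists].
Qed.

Lemma bRs_ex (F : fieldType) (X Y Z : finType) (Phi : {set X * Y * Z}) :
  exists r, bRs_pred F Phi r.
Proof.
have [r /asboolP [T [H1 H2]]] := Rs_ex F Phi.
by exists r; apply/asboolP; exists T; split => //; apply: rank_le_border.
Qed.

Definition Rs (F : fieldType) (X Y Z : finType) (Phi : {set X * Y * Z}) : nat :=
  ex_minn (Rs_ex F Phi).

Definition bRs (F : fieldType) (X Y Z : finType) (Phi : {set X * Y * Z}) : nat :=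
  ex_minn (bRs_ex F Phi).

Definition supp_pow (X Y Z : finType) (Phi : {set X * Y * Z}) (n : nat)
  : {set {ffun 'I_n -> X} * {ffun 'I_n -> Y} * {ffun 'I_n -> Z}} :=
  [set t : {ffun 'I_n -> X} * {ffun 'I_n -> Y} * {ffun 'I_n -> Z} |
     [forall i : 'I_n, (t.1.1 i, t.1.2 i, t.2 i) \in Phi]].

Definition brak (I J K : finType) (Lam : {set I * J * K})
  : {set (I * J) * (J * K) * (K * I)} :=
  [set ((p.1.1, p.1.2), (p.1.2, p.2), (p.2, p.1.1)) | p in Lam].

(* support of the matrix multiplication tensor <l,m,n> *)
Definition mm_supp (l m n : nat) := brak [set: 'I_l * 'I_m * 'I_n].

Definition log2 (R : realType) (x : R) : R := ln x / ln 2.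

Definition aRs (R : realType) (F : fieldType) (X Y Z : finType)
  (Phi : {set X * Y * Z}) : R :=
  limn (fun n : nat => ((Rs F (supp_pow Phi n))%:R : R) `^ (n%:R)^-1).

Definition fl2 (R : realType) (x : R) : nat := Num.truncn ((2 : R) `^ x).

Definition omega_s (R : realType) (F : fieldType) (a b c : R) : R :=
  limn (fun n : nat => (n%:R)^-1 *
    log2 ((Rs F (mm_supp (fl2 (a * n%:R)) (fl2 (b * n%:R)) (fl2 (c * n%:R))))%:R : R)).

Definition is_distr_on (R : realType) (T : finType) (Lam : {set T}) (P : T -> R) :=
  (forall t, 0 <= P t) /\ (forall t, t \notin Lam -> P t = 0) /\
  \sum_t P t = 1.

Definition marg (R : realType) (T U : finType) (f : T -> U) (P : T -> R) : U -> R :=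
  fun u => \sum_(t | f t == u) P t.

(* Shannon entropy (base 2); note ln 0 = 0, so 0 log 0 = 0 *)
Definition entropy (R : realType) (U : finType) (q : U -> R) : R :=
  - \sum_u q u * log2 (q u).

Definition infinite_field (F : fieldType) : Prop :=
  forall s : seq F, exists x : F, x \notin s.

(* Main.v *)
(** Three ideas give the theorem.

    (1) Over an infinite field, merging variables after scaling them generically
    cannot create a cancellation, so [Rs] of the image of a support under any maps of
    the three variable sets is at most [Rs] of the support.  Hence a family of maps
    (f, g, h) from I^n, J^n, K^n to [A], [B], [C] such that the images of Lam^n cover
    [A] x [B] x [C] yields [Rs <A,B,C> <= m * Rs <Lam>^n], where m is the size of the
    family.  For random maps, the second moment method applied to the iid measure of P
    restricted to typical sequences shows that each triple is covered with probability
    2^(-o(n)) as soon as the entropy conditions hold, so that m = 2^(o(n)) suffices.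

    (2) If T has border rank at most r, then its n-th power is a linear combination of
    n-th powers of tensors of rank at most r over F itself: a linear functional
    vanishing on those powers is a polynomial vanishing on the tensors of rank at most
    r.  The number of terms is at most the number of monomials, which is polynomial
    in n.

    (3) For the last inequality take P uniform on Lam and a = H(I), b = H(IJ) - H(I),
    c = H(IJK) - H(IJ); the entropy conditions are submodularity.  Multiplying the
    three cyclic rotations of <A,B,C> turns a bound for the format (a, b, c) into one
    for a cube of side 2^(a+b+c). *)

Require Import Defs.
From HB Require Import structures.
From mathcomp Require Import all_boot all_order all_algebra all_field.
From mathcomp Require Import ring_quotient.
From mathcomp Require Import all_classical all_reals all_analysis.
From mathcomp Require Import ring lra.
From mathcomp Require mpoly.
Import (canonicals) mpoly.
Import Order.TTheory GRing.Theory Num.Theory.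
Import numFieldNormedType.Exports.
Set Implicit Arguments.
Unset Strict Implicit.
Unset Printing Implicit Defensive.
Local Open Scope ring_scope.

(** * Algebraically closed extensions of arbitrary fields *)

Section Ultraproduct.
Variables (I : pointedType) (K : I -> closedFieldType).

Definition fprod : Type := forall i, K i.

HB.instance Definition _ := gen_eqMixin fprod.
HB.instance Definition _ := gen_choiceMixin fprod.

Let add (f g : fprod) : fprod := fun i => f i + g i.
Let opp (f : fprod) : fprod := fun i => - f i.
Let mul (f g : fprod) : fprod := fun i => f i * g i.
Let zero : fprod := fun=> 0.
Let one : fprod := fun=> 1.

Fact fprod_addA : associative add.
Proof. by move=> f g h; apply: functional_extensionality_dep => i; exact: addrA. Qed.
Fact fprod_addC : commutative add.
Proof. by move=> f g; apply: functional_extensionality_dep => i; exact: addrC. Qed.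
Fact fprod_add0 : left_id zero add.
Proof. by move=> f; apply: functional_extensionality_dep => i; exact: add0r. Qed.
Fact fprod_addN : left_inverse zero opp add.
Proof. by move=> f; apply: functional_extensionality_dep => i; exact: addNr. Qed.

HB.instance Definition _ :=
  GRing.isZmodule.Build fprod fprod_addA fprod_addC fprod_add0 fprod_addN.

Fact fprod_mulA : associative mul.
Proof. by move=> f g h; apply: functional_extensionality_dep => i; exact: mulrA. Qed.
Fact fprod_mulC : commutative mul.
Proof. by move=> f g; apply: functional_extensionality_dep => i; exact: mulrC. Qed.
Fact fprod_mul1 : left_id one mul.
Proof. by move=> f; apply: functional_extensionality_dep => i; exact: mul1r. Qed.
Fact fprod_mulDl : left_distributive mul add.
Proof. by move=> f g h; apply: functional_extensionality_dep => i; exact: mulrDl. Qed.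
Fact fprod_one_neq0 : one != zero.
Proof.
by apply/eqP => /(congr1 (@^~ point)) /eqP; rewrite (negbTE (oner_neq0 _)).
Qed.

HB.instance Definition _ := GRing.Zmodule_isComNzRing.Build fprod
  fprod_mulA fprod_mulC fprod_mul1 fprod_mulDl fprod_one_neq0.

Lemma fprodX (f : fprod) n i : (f ^+ n) i = f i ^+ n.
Proof. by elim: n => // n IH; rewrite !exprS -IH. Qed.

Lemma fprod_sum n (f : 'I_n -> fprod) i : (\sum_j f j) i = \sum_j f j i.
Proof. by elim/big_ind2: _ => // ? ? ? ? <- <-. Qed.

Variables (U : set_system I) (ultraU : UltraFilter U).

(** Families that vanish on a set of the ultrafilter; the quotient by this ideal is the ultraproduct
    of the fields [K i]. *)
Definition null_ideal : pred fprod := fun f => `[< U [set i | f i = 0]%classic >].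

Fact null_idealr_closed : idealr_closed null_ideal.
Proof.
split.
- by apply/asboolP; apply: filterE.
- apply/asboolP => /= H; apply: (@filter_not_empty _ U).
  by apply: filterS H => i /eqP; rewrite (negbTE (oner_neq0 _)).
- move=> a u v /asboolP Hu /asboolP Hv; apply/asboolP.
  apply: filterS2 Hu Hv => i /= ui vi.
  by rewrite /GRing.add /GRing.mul /= /add /mul ui vi mulr0 addr0.
Qed.

HB.instance Definition _ := isIdealr.Build fprod null_ideal null_idealr_closed.

Definition ultraprod := {ideal_quot (null_ideal : idealr fprod)}.
HB.instance Definition _ := GRing.ComNzRing.on ultraprod.

Local Open Scope quotient_scope.
Local Notation pi := (\pi_ultraprod : fprod -> ultraprod).

(** The equational case of the theorem of Los: it lets identities in the ultraproduct be checked
    index by index. *)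
Lemma pi_eqP f g : pi f = pi g <-> U [set i | f i = g i]%classic.
Proof.
split=> [/eqP|H].
  rewrite -Quotient.idealrBE => /asboolP; apply: filterS => i /= /eqP.
  by rewrite subr_eq0 => /eqP.
apply/eqP; rewrite -Quotient.idealrBE; apply/asboolP; apply: filterS H => i /= H.
by apply/eqP; rewrite subr_eq0 H.
Qed.

Definition ultraprod_inv (x : ultraprod) : ultraprod := pi (fun i => (repr x i)^-1).

Fact ultraprod_mulVf (x : ultraprod) : x != 0 -> ultraprod_inv x * x = 1.
Proof.
move=> x0; rewrite -{2}[x]reprK /ultraprod_inv -rmorphM -[1](rmorph1 pi).
apply/pi_eqP.
(* The ultrafilter contains either the zero set of the representative, and then [x] is 0, or its
   complement, on which the pointwise inverse works. *)
have [H|] := in_ultra_setVsetC [set i | repr x i = 0]%classic ultraU.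
  case/negP: x0; rewrite -[x]reprK -[0](rmorph0 pi).
  by apply/eqP/pi_eqP.
apply: filterS => i /= /eqP xi.
by rewrite /GRing.mul /= /mul mulVf.
Qed.

Fact ultraprod_inv0 : ultraprod_inv 0 = 0.
Proof.
rewrite /ultraprod_inv -[RHS](rmorph0 pi); apply/pi_eqP.
have /pi_eqP : pi (repr (0 : ultraprod)) = pi 0 by rewrite reprK rmorph0.
by apply: filterS => i /= ->; rewrite invr0.
Qed.

HB.instance Definition _ :=
  GRing.ComNzRing_isField.Build ultraprod ultraprod_mulVf ultraprod_inv0.

Fact ultraprod_closed : GRing.closed_field_axiom ultraprod.
Proof.
move=> n P n0.
have H i : exists x : K i, x ^+ n = \sum_(j < n) repr (P j) i * x ^+ j.
  exact: (@solve_monicpoly (K i) n (fun j => repr (P j) i) n0).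
pose x : fprod := fun i => projT1 (cid (H i)).
exists (pi x); rewrite -rmorphXn.
rewrite (eq_bigr (fun j : 'I_n => pi (repr (P j) * x ^+ j))); last first.
  move=> j _; rewrite rmorphM rmorphXn; congr (_ * _); exact/esym/reprK.
rewrite -rmorph_sum; apply/pi_eqP; apply: filterE => i /=.
rewrite fprodX (projT2 (cid (H i))) fprod_sum; apply: eq_bigr => j _.
by rewrite /GRing.mul /= /mul fprodX.
Qed.

HB.instance Definition _ := Field_isAlgClosed.Build ultraprod ultraprod_closed.

End Ultraproduct.

(** * Countable subfields generated by finite sequences *)

Section CountableSubfield.
Variables (F : fieldType) (s : seq F).

(** Trees code the expressions built from the entries of [s] by subtraction and division; every
    other node codes 1. There are countably many trees, so the subfield of values is countable, as
    the construction of its algebraic closure requires. *)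
Fixpoint tree_eval (t : GenTree.tree nat) : F :=
  match t with
  | GenTree.Leaf i => s`_i
  | GenTree.Node 0 [:: a; b] => tree_eval a - tree_eval b
  | GenTree.Node 1 [:: a; b] => tree_eval a / tree_eval b
  | GenTree.Node _ _ => 1
  end.

Definition gen_field : pred F := fun x => `[< exists t, tree_eval t = x >].

Fact gen_field_divring_closed : divring_closed gen_field.
Proof.
split; first by apply/asboolP; exists (GenTree.Node 2 [::]).
- move=> x y /asboolP[a <-] /asboolP[b <-]; apply/asboolP.
  by exists (GenTree.Node 0 [:: a; b]).
- move=> x y /asboolP[a <-] /asboolP[b <-]; apply/asboolP.
  by exists (GenTree.Node 1 [:: a; b]).
Qed.

HB.instance Definition _ :=
  GRing.isDivringClosed.Build F gen_field gen_field_divring_closed.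

Record subfield := Subfield { subfield_val : F; _ : subfield_val \in gen_field }.

HB.instance Definition _ := [isSub for subfield_val].
HB.instance Definition _ := [Choice of subfield by <:].
HB.instance Definition _ := [SubChoice_isSubIntegralDomain of subfield by <:].
HB.instance Definition _ := [SubIntegralDomain_isSubField of subfield by <:].

Let code (x : subfield) : GenTree.tree nat := projT1 (cid (asboolW (valP x))).
Let decode (t : GenTree.tree nat) : subfield := insubd 0 (tree_eval t).
Fact codeK : cancel code decode.
Proof.
move=> x; apply: val_inj; rewrite /decode /code; case: cid => t /= ->.
by rewrite insubdK //; case: x.
Qed.
HB.instance Definition _ := CanIsCountable codeK.

Lemma mem_gen_field x : x \in s -> x \in gen_field.
Proof.
by move=> xs; apply/asboolP; exists (GenTree.Leaf (index x s)); rewrite /= nth_index.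
Qed.

End CountableSubfield.

(* An ultraproduct, over the finite subsets [s] of [F], of the algebraic
   closures of the countable subfields generated by [s]. *)
Lemma closed_extension (F : fieldType) :
  inhabited {L : closedFieldType & {rmorphism F -> L}}.
Proof.
pose I : pointedType := HB.pack (seq F) (isPointed.Build (seq F) [::]).
pose K (s : I) : closedFieldType :=
  projT1 (countable_algebraic_closure (subfield s)).
pose e (s : I) : {rmorphism subfield s -> K s} :=
  projT1 (projT2 (countable_algebraic_closure (subfield s))).
(* The sequences containing a given one form the basic sets of a proper filter. For an ultrafilter
   refining it, any finite part of [F] lies in almost all the subfields. *)
pose base (s : I) : set I := [set s' : seq F | {subset s <= s'}]%classic.
have base_filter : Filter (filter_from setT base).
  apply: filter_fromT_filter; first by exists point.
  move=> s t; exists (s ++ t : seq F) => r st; split=> x xs; apply: st;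
    by rewrite mem_cat xs ?orbT.
have base_proper : ProperFilter (filter_from setT base).
  by apply: filter_from_proper => // s _; exists s => x.
have [U [ultraU baseU]] := ultraFilterLemma base_proper.
pose pi := \pi_(ultraprod K ultraU)%qT : fprod K -> ultraprod K ultraU.
(* Where [x] lies outside the subfield, [insubd] returns 0. Each identity below involves finitely
   many elements, which all lie in the subfield for a large set of indices, so this default does no
   harm. *)
pose phi (x : F) : ultraprod K ultraU := pi (fun s => e s (insubd 0 x)).
have near_mem (l : seq F) : U [set s : seq F | {subset l <= gen_field s}]%classic.
  by apply: baseU; exists l => //= s ls x /ls; exact: mem_gen_field.
have phiB : zmod_morphism phi.
  move=> x y; rewrite /phi -rmorphB; apply/pi_eqP.
  apply: filterS (near_mem [:: x; y; x - y]) => s /= H.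
  rewrite [RHS](_ : _ = e s (insubd 0 x) - e s (insubd 0 y)) // -rmorphB.
  congr (e s _); apply: val_inj.
  by rewrite rmorphB /= !insubdK //; apply: H; rewrite !inE eqxx ?orbT.
have phiM : monoid_morphism phi.
  split=> [|x y].
    rewrite /phi -[RHS](rmorph1 pi); apply/pi_eqP.
    apply: filterS (near_mem [:: 1]) => s /= H.
    rewrite [RHS](_ : _ = 1) // -[RHS](rmorph1 (e s)); congr (e s _).
    apply: val_inj; rewrite insubdK //; last by apply: H; rewrite !inE eqxx.
  rewrite /phi -rmorphM; apply/pi_eqP.
  apply: filterS (near_mem [:: x; y; x * y]) => s /= H.
  rewrite [RHS](_ : _ = e s (insubd 0 x) * e s (insubd 0 y)) // -rmorphM.
  congr (e s _); apply: val_inj.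
  by rewrite rmorphM /= !insubdK //; apply: H; rewrite !inE eqxx ?orbT.
pose phiA := GRing.isZmodMorphism.Build _ _ phi phiB.
pose phiMM := GRing.isMonoidMorphism.Build _ _ phi phiM.
constructor; exists (ultraprod K ultraU).
exact: (HB.pack_for {rmorphism F -> ultraprod K ultraU} phi phiA phiMM).
Qed.

(** * Rank and support rank *)

(** [F] supplies [size p] distinct points, their images under [phi] stay distinct, and a nonzero [p]
    has fewer roots than that. *)
Lemma infinite_nonroot_morph (F L : fieldType) (phi : {rmorphism F -> L})
  (p : {poly L}) : infinite_field F -> p != 0 -> exists x, p.[phi x] != 0.
Proof.
move=> Finf p0; apply: contrapT => H.
have roots n : exists s : seq F, uniq s && (size s == n).
  elim: n => [|n [s /andP[us /eqP <-]]]; first by exists [::].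
  by have [x xs] := Finf s; exists (x :: s); rewrite /= xs us eqxx.
have [s /andP[us /eqP sz]] := roots (size p).
suff : (size p < size p)%N by rewrite ltnn.
rewrite -{1}sz -(size_map phi); apply: max_poly_roots => //.
  apply/allP => _ /mapP[x _ ->]; apply/negPn/negP => xp.
  by apply: H; exists x.
by rewrite map_inj_uniq //; exact: fmorph_inj.
Qed.

Lemma infinite_nonroot (F : fieldType) (p : {poly F}) :
  infinite_field F -> p != 0 -> exists x, p.[x] != 0.
Proof. exact: (@infinite_nonroot_morph F F idfun). Qed.

(** It suffices to avoid the roots of the product of the polynomials. *)
Lemma infinite_nonroot_all (F : fieldType) (I : finType) (p : I -> {poly F})
  (A : {set I}) : infinite_field F -> (forall i, i \in A -> p i != 0) ->
  exists x, forall i, i \in A -> (p i).[x] != 0.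
Proof.
move=> Finf pA.
have [|x xP] := @infinite_nonroot F (\prod_(i in A) p i) Finf.
  by apply/prodf_neq0.
exists x => i iA; move: xP; rewrite horner_prod => /prodf_neq0; exact.
Qed.

Section Rank.
Variable F : fieldType.

Lemma rank_le_fin (X Y Z I : finType) (T : X * Y * Z -> F)
    (u : I -> X -> F) (v : I -> Y -> F) (w : I -> Z -> F) :
  (forall t, T t = \sum_i u i t.1.1 * v i t.1.2 * w i t.2) -> rank_le T #|I|.
Proof.
move=> H; exists (u \o enum_val), (v \o enum_val), (w \o enum_val) => t.
by rewrite H (reindex _ (onW_bij _ (enum_val_bij I))).
Qed.

Lemma rank_leD (X Y Z : finType) (T T' : X * Y * Z -> F) r r' :
  rank_le T r -> rank_le T' r' -> rank_le (fun t => T t + T' t) (r + r').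
Proof.
move=> [u [v [w H]]] [u' [v' [w' H']]].
pose f (A : Type) (g : 'I_r -> A) (h : 'I_r' -> A) (i : 'I_r + 'I_r') :=
  match i with inl i => g i | inr i => h i end.
have := @rank_le_fin X Y Z _ (fun t => T t + T' t) (f _ u u') (f _ v v') (f _ w w').
by rewrite card_sum !card_ord; apply => t; rewrite big_sumType /= H H'.
Qed.

Lemma rank_le0 (X Y Z : finType) r : rank_le (fun=> 0 : F) r (X := X) (Y := Y) (Z := Z).
Proof. by do 3!exists (fun _ _ => 0); move=> t; rewrite big1 // => *; rewrite !mulr0. Qed.

Lemma rank_le_trans (X Y Z : finType) (T : X * Y * Z -> F) r r' :
  (r <= r')%N -> rank_le T r -> rank_le T r'.
Proof.
move=> /subnKC <- H; have [u [v [w E]]] := rank_leD H (@rank_le0 X Y Z (r' - r)).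
by exists u, v, w => t; rewrite -E addr0.
Qed.

Lemma rank_leZ (X Y Z : finType) (T : X * Y * Z -> F) c r :
  rank_le T r -> rank_le (fun t => c * T t) r.
Proof.
move=> [u [v [w H]]]; exists (fun l x => c * u l x), v, w => t.
by rewrite H mulr_sumr; apply: eq_bigr => l _; rewrite !mulrA.
Qed.

Lemma rank_le_sum (X Y Z : finType) k (T : 'I_k -> X * Y * Z -> F) r :
  (forall i, rank_le (T i) r) -> rank_le (fun t => \sum_i T i t) (k * r).
Proof.
elim: k T => [|k IH] T H.
  have [u [v [w E]]] := @rank_le0 X Y Z 0.
  by exists u, v, w => t; rewrite -E big_ord0.
have [u [v [w E]]] := rank_leD (H ord0) (IH _ (fun i => H (lift ord0 i))).
by exists u, v, w => t; rewrite -E big_ord_recl.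
Qed.

Lemma rank_le_pow (X Y Z : finType) (T : X * Y * Z -> F) r n : rank_le T r ->
  rank_le (fun t : {ffun 'I_n -> X} * {ffun 'I_n -> Y} * {ffun 'I_n -> Z} =>
    \prod_i T (t.1.1 i, t.1.2 i, t.2 i)) (r ^ n).
Proof.
move=> [u [v [w H]]].
pose pw (A : finType) (g : 'I_r -> A -> F) (f : {ffun 'I_n -> 'I_r})
  (x : {ffun 'I_n -> A}) := \prod_i g (f i) (x i).
have := @rank_le_fin _ _ _ _ _ (pw _ u) (pw _ v) (pw _ w).
rewrite card_ffun !card_ord; apply => t.
under eq_bigr do rewrite H /=.
by rewrite bigA_distr_bigA; apply: eq_bigr => f _; rewrite -!big_split.
Qed.

Lemma rank_le_prod (X Y Z X' Y' Z' : finType) (T : X * Y * Z -> F)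
    (T' : X' * Y' * Z' -> F) r r' : rank_le T r -> rank_le T' r' ->
  rank_le (fun t : (X * X') * (Y * Y') * (Z * Z') =>
    T (t.1.1.1, t.1.2.1, t.2.1) * T' (t.1.1.2, t.1.2.2, t.2.2)) (r * r').
Proof.
move=> [u [v [w H]]] [u' [v' [w' H']]].
pose pw (A A' : finType) (g : 'I_r -> A -> F) (g' : 'I_r' -> A' -> F)
  (i : 'I_r * 'I_r') (x : A * A') := g i.1 x.1 * g' i.2 x.2.
have := @rank_le_fin _ _ _ _ _ (pw _ _ u u') (pw _ _ v v') (pw _ _ w w').
rewrite card_prod !card_ord; apply => t.
rewrite H H' /= mulr_suml -(pair_bigA _ (fun i j => pw _ _ u u' (i, j) t.1.1 *
  pw _ _ v v' (i, j) t.1.2 * pw _ _ w w' (i, j) t.2)) /=.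
apply: eq_bigr => i _; rewrite mulr_sumr; apply: eq_bigr => j _.
by rewrite /pw /=; ring.
Qed.

Lemma rank_le_subst (X Y Z X' Y' Z' : finType) (T : X * Y * Z -> F) r
    (f : X -> X') (g : Y -> Y') (h : Z -> Z') (c : X -> F) (d : Y -> F) (e : Z -> F) :
  rank_le T r -> rank_le (fun t' : X' * Y' * Z' =>
    \sum_(t | (f t.1.1, g t.1.2, h t.2) == t') c t.1.1 * d t.1.2 * e t.2 * T t) r.
Proof.
move=> [u [v [w H]]].
exists (fun l x' => \sum_(x | f x == x') c x * u l x).
exists (fun l y' => \sum_(y | g y == y') d y * v l y).
exists (fun l z' => \sum_(z | h z == z') e z * w l z).
move=> [[x' y'] z'] /=.
under eq_bigr do rewrite H mulr_sumr.
rewrite exchange_big /=; apply: eq_bigr => l _.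
rewrite big_distrlr /= pair_big /= big_distrlr /= pair_big /=.
apply: eq_big => [[[x y] z]|[[x y] z] _] /=; first by rewrite !xpair_eqE.
by ring.
Qed.

End Rank.

(** * Support rank of products, unions and images *)

Section SupportRank.
Variable F : fieldType.

Lemma Rs_leP (X Y Z : finType) (Phi : {set X * Y * Z}) r :
  reflect (exists T : X * Y * Z -> F, Defs.support T = Phi /\ rank_le T r)
          (Rs F Phi <= r)%N.
Proof.
rewrite /Rs; case: ex_minnP => m Pm min_m.
apply: (iffP idP) => [mr|H]; last by apply: min_m; apply/asboolP.
move/asboolP: Pm => [T [TPhi Tm]].
by exists T; split=> //; exact: rank_le_trans Tm.
Qed.

Lemma RsP (X Y Z : finType) (Phi : {set X * Y * Z}) :
  exists T : X * Y * Z -> F, Defs.support T = Phi /\ rank_le T (Rs F Phi).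
Proof. exact/Rs_leP. Qed.

Lemma Rs_gt0 (X Y Z : finType) (Phi : {set X * Y * Z}) :
  Phi != finset.set0 -> (0 < Rs F Phi)%N.
Proof.
move=> /set0Pn[t tPhi]; have [T [TPhi [u [v [w TE]]]]] := RsP Phi.
case: (Rs F Phi) u v w TE => // u v w TE.
by move: tPhi; rewrite -TPhi inE TE big_ord0 eqxx.
Qed.

Lemma Rs_prod (X Y Z X' Y' Z' : finType) (Phi : {set X * Y * Z})
    (Psi : {set X' * Y' * Z'}) :
  (Rs F [set t : (X * X') * (Y * Y') * (Z * Z') |
     ((t.1.1.1, t.1.2.1, t.2.1) \in Phi) && ((t.1.1.2, t.1.2.2, t.2.2) \in Psi)]
   <= Rs F Phi * Rs F Psi)%N.
Proof.
have [T [<- rT]] := RsP Phi; have [T' [<- rT']] := RsP Psi.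
apply/Rs_leP; eexists; split; last exact: rank_le_prod rT rT'.
by apply/setP => t; rewrite !inE mulf_eq0 negb_or.
Qed.

Hypothesis Finf : infinite_field F.

(** To a tensor for [A] is added a generic multiple [c] of one for [B]: at each position of the
    union the entry is a nonzero polynomial in [c], so no cancellation occurs. *)
Lemma RsU (X Y Z : finType) (A B : {set X * Y * Z}) :
  (Rs F (A :|: B) <= Rs F A + Rs F B)%N.
Proof.
have [T [TA rT]] := RsP A; have [T' [TB rT']] := RsP B.
have [|c cP] := @infinite_nonroot_all F _ (fun t => (T t)%:P + T' t *: 'X) (A :|: B) Finf.
  move=> t; apply: contraTneq => /polyP E.
  have := E 0%N; have := E 1%N.
  rewrite !coefD !coefC !coefZ !coefX /= !mulr1 !mulr0 !addr0 add0r.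
  by rewrite -TA -TB !inE => -> ->; rewrite eqxx.
apply/Rs_leP; eexists; split; last exact: (rank_leD rT (rank_leZ c rT')).
apply/setP => t; apply/idP/idP.
  rewrite -TA -TB !inE; apply: contraNT; rewrite negb_or !negbK => /andP[/eqP-> /eqP->].
  by rewrite mulr0 addr0.
by move/cP; rewrite inE !hornerE mulrC.
Qed.

Lemma Rs0 (X Y Z : finType) : Rs F (finset.set0 : {set X * Y * Z}) = 0%N.
Proof.
apply/eqP; rewrite -leqn0; apply/Rs_leP; exists (fun=> 0).
by split; [apply/setP => t; rewrite !inE eqxx | exact: rank_le0].
Qed.

Lemma Rs_bigcup (X Y Z : finType) (I : Type) (s : seq I) (A : I -> {set X * Y * Z}) r :
  (forall i, Rs F (A i) <= r)%N ->
  (Rs F (\big[@finset.setU _/finset.set0]_(i <- s) A i) <= size s * r)%N.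
Proof.
move=> H; elim: s => [|i s IH]; first by rewrite big_nil Rs0.
by rewrite big_cons (leq_trans (RsU _ _)) //= mulSn leq_add.
Qed.

(* A single variable [theta], with [x_a], [y_b], [z_c] scaled by powers of [theta]
   whose exponents are the digits of a mixed radix expansion, is generic enough:
   the summands merged into one coefficient get distinct powers of [theta]. *)
Lemma Rs_image (X Y Z X' Y' Z' : finType) (Phi : {set X * Y * Z})
    (f : X -> X') (g : Y -> Y') (h : Z -> Z') :
  (Rs F [set (f t.1.1, g t.1.2, h t.2) | t in Phi] <= Rs F Phi)%N.
Proof.
have [T [TPhi rT]] := RsP Phi.
pose cX (x : X) : nat := enum_rank x.
pose cY (y : Y) : nat := #|X| * enum_rank y.
pose cZ (z : Z) : nat := #|X| * (#|Y| * enum_rank z).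
pose code (t : X * Y * Z) : nat := (cX t.1.1 + cY t.1.2 + cZ t.2)%N.
have code_inj : injective code.
  move=> [[x y] z] [[x' y'] z']; rewrite /code /cX /cY /cZ /= -!addnA -!mulnDr => E.
  have X0 : (0 < #|X|)%N by apply: leq_ltn_trans (ltn_ord (enum_rank x)).
  have Y0 : (0 < #|Y|)%N by apply: leq_ltn_trans (ltn_ord (enum_rank y)).
  have Ex : x = x'.
    apply: enum_rank_inj; apply: val_inj.
    have := congr1 (modn^~ #|X|) E; rewrite ![(#|X| * _)%N]mulnC !(addnC (enum_rank _)).
    by rewrite !modnMDl !modn_small.
  have E2 : (enum_rank y + #|Y| * enum_rank z = enum_rank y' + #|Y| * enum_rank z')%N.
    by move: E; rewrite Ex => /addnI /eqP; rewrite eqn_pmul2l // => /eqP.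
  have Ey : y = y'.
    apply: enum_rank_inj; apply: val_inj.
    have := congr1 (modn^~ #|Y|) E2; rewrite ![(#|Y| * _)%N]mulnC !(addnC (enum_rank _)).
    by rewrite !modnMDl !modn_small.
  move: E2; rewrite Ey => /addnI /eqP; rewrite eqn_pmul2l // => /eqP /val_inj /enum_rank_inj ->.
  by rewrite Ex.
pose p t' := \sum_(t | (f t.1.1, g t.1.2, h t.2) == t') T t *: 'X^(code t).
pose Psi := [set (f t.1.1, g t.1.2, h t.2) | t in Phi].
have [|c cP] := @infinite_nonroot_all F _ p Psi Finf.
  move=> t' /imsetP[t tPhi ->]; apply/eqP => /polyP /(_ (code t)).
  rewrite coef0 coef_sum (bigD1 t) //= coefZ coefXn eqxx mulr1 big1 ?addr0.
    by move/eqP; apply/negP; move: tPhi; rewrite -TPhi inE.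
  move=> s /andP[_ st]; rewrite coefZ coefXn.
  have [/code_inj E|] := eqVneq (code t) (code s); last by rewrite mulr0.
  by rewrite E eqxx in st.
apply/Rs_leP; eexists; split.
  2: exact: (rank_le_subst f g h (fun x => c ^+ cX x) (fun y => c ^+ cY y) (fun z => c ^+ cZ z) rT).
have pE t' : \sum_(t | (f t.1.1, g t.1.2, h t.2) == t')
    c ^+ cX t.1.1 * c ^+ cY t.1.2 * c ^+ cZ t.2 * T t = (p t').[c].
  rewrite horner_sum; apply: eq_bigr => t _.
  by rewrite hornerZ hornerXn /code !exprD mulrC.
apply/setP => t'; rewrite inE pE; apply/idP/idP; last exact: cP.
rewrite -pE => H; apply/negPn/negP => t'Psi; case/eqP: H.
apply: big1 => t /eqP tt'; apply/eqP; rewrite mulf_eq0; apply/orP; right.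
apply/negPn/negP => Tt; case/negP: t'Psi; rewrite -tt'.
by apply: imset_f; rewrite -TPhi inE.
Qed.

Lemma Rs_image_eq (X Y Z X' Y' Z' : finType) (Phi : {set X * Y * Z})
    (Psi : {set X' * Y' * Z'}) (f : X -> X') (g : Y -> Y') (h : Z -> Z') :
  (forall t, t \in Phi -> (f t.1.1, g t.1.2, h t.2) \in Psi) ->
  (forall t', t' \in Psi -> exists2 t, t \in Phi & (f t.1.1, g t.1.2, h t.2) = t') ->
  (Rs F Psi <= Rs F Phi)%N.
Proof.
move=> sub sup; rewrite [Psi](_ : _ = [set (f t.1.1, g t.1.2, h t.2) | t in Phi]).
  exact: Rs_image.
apply/setP => t'; apply/idP/imsetP => [/sup[t tPhi <-]|[t tPhi ->]]; last exact: sub.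
by exists t.
Qed.

End SupportRank.

(** * Powers of tensors of bounded border rank *)

Lemma meval_horner (L : fieldType) d (p : mpoly.mpoly d L) (q : 'I_d -> {poly L}) :
  exists Q : {poly L}, forall x, Q.[x] = mpoly.meval (fun i => (q i).[x]) p.
Proof.
exists (\sum_(m <- mpoly.msupp p)
  (mpoly.mcoeff m p)%:P * \prod_i q i ^+ mpoly.fun_of_multinom m i) => x.
rewrite mpoly.mevalE horner_sum; apply: eq_bigr => m _.
by rewrite hornerM hornerC horner_prod; under eq_bigr do rewrite horner_exp.
Qed.

Section Transfer.
Variables (F L : fieldType) (phi : {rmorphism F -> L}) (Finf : infinite_field F).
Variables (X Y Z : finType) (r : nat).

(** All coordinates of the [3 r] linear forms are gathered in the single family [th], so that they
    can be treated one at a time. *)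
Definition param_tensor (A : pzRingType) (th : 'I_r * (X + Y + Z) -> A)
  (t : X * Y * Z) : A :=
  \sum_l th (l, inl (inl t.1.1)) * th (l, inl (inr t.1.2)) * th (l, inr t.2).

Lemma rank_le_param (A : pzRingType) (T : X * Y * Z -> A) :
  rank_le T r <-> exists th, forall t, T t = param_tensor th t.
Proof.
split=> [[u [v [w H]]]|[th H]].
  exists (fun c => match c.2 with inl (inl x) => u c.1 x | inl (inr y) => v c.1 y
                 | inr z => w c.1 z end) => t.
  exact: H.
exists (fun l x => th (l, inl (inl x))), (fun l y => th (l, inl (inr y))),
  (fun l z => th (l, inr z)) => t.
exact: H.
Qed.

(* The coordinates in [s] are freed from the image of [F] one at a time: as a
   polynomial in the freed coordinate, the value of [p] has infinitely many roots. *)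
Lemma vanish_transfer (p : mpoly.mpoly #|{: X * Y * Z}| L) :
  (forall S : X * Y * Z -> F, rank_le S r ->
     mpoly.meval (fun i => phi (S (enum_val i))) p = 0) ->
  forall S : X * Y * Z -> L, rank_le S r ->
     mpoly.meval (fun i => S (enum_val i)) p = 0.
Proof.
move=> vanF S /rank_le_param[th SE].
rewrite (_ : (fun i => S (enum_val i)) = (fun i => param_tensor th (enum_val i))); last first.
  by apply/funext => i.
suff: forall (s : seq ('I_r * (X + Y + Z))) (th : 'I_r * (X + Y + Z) -> L),
    (forall c, c \notin s -> exists a, th c = phi a) ->
    mpoly.meval (fun i => param_tensor th (enum_val i)) p = 0.
  by move=> /(_ (enum {: 'I_r * (X + Y + Z)}) th); apply=> c; rewrite mem_enum.
elim=> [|c s IH] {S SE}th thP.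
  pose th0 c := projT1 (cid (thP c isT)).
  rewrite -[RHS](vanF (param_tensor th0)); last by apply/rank_le_param; exists th0.
  congr (mpoly.meval _ p); apply/funext => i.
  rewrite rmorph_sum; apply: eq_bigr => l _.
  by rewrite !rmorphM /th0 -!(projT2 (cid (thP _ isT))).
pose upd x c' := if c' == c then x else th c'.
pose thX c' : {poly L} := if c' == c then 'X else (th c')%:P.
have [Q QE] := meval_horner p (fun i => param_tensor thX (enum_val i)).
have {}QE x : Q.[x] = mpoly.meval (fun i => param_tensor (upd x) (enum_val i)) p.
  rewrite QE; congr (mpoly.meval _ p); apply/funext => i.
  have thXE c' : (thX c').[x] = upd x c'.
    by rewrite /thX /upd; case: ifP; rewrite ?hornerX ?hornerC.
  by rewrite horner_sum; apply: eq_bigr => l _; rewrite !hornerM !thXE.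
have Q0 : Q = 0.
  apply/eqP/negPn/negP => /(infinite_nonroot_morph phi Finf)[x /eqP]; apply.
  rewrite QE; apply: IH => c' c's; rewrite /upd.
  have [_|c'c] := eqVneq c' c; first by exists x.
  by apply: thP; rewrite inE (negbTE c'c).
rewrite -[RHS](horner0 (th c)) -Q0 QE; congr (mpoly.meval _ p); apply/funext => i.
by apply: eq_bigr => l _; rewrite /upd; do 3!case: eqP => [->|_] //.
Qed.

End Transfer.

(** A maximal linearly independent family of rows taken from [A] itself spans [A], and independence
    bounds its size by [N]. *)
Lemma finite_row_span (F : fieldType) N (A : set 'rV[F]_N) :
  exists k (M : 'M[F]_(k, N)), [/\ (k <= N)%N, forall i, A (row i M) &
    forall v, A v -> (v <= M)%MS].
Proof.
pose P k := `[< exists M : 'M[F]_(k, N), (forall i, A (row i M)) /\ row_free M >].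
have P0 : exists k, P k.
  exists 0%N; apply/asboolP; exists 0; split; first by case.
  by rewrite /row_free mxrank0.
have PN k : P k -> (k <= N)%N.
  by move=> /asboolP[M [_ /eqP <-]]; exact: rank_leq_col.
case: (ex_maxnP P0 PN) => k Pk kmax; exists k.
have /asboolP[M [AM freeM]] := Pk; exists M; split=> //; first exact: PN.
move=> v Av; apply/negPn/negP => vM.
suff /kmax : P (k + 1)%N by rewrite addn1 ltnn.
apply/asboolP; exists (col_mx M v); split=> [i|].
  case: (split_ordP i) => j ->.
    by rewrite rowKu.
  by rewrite rowKd (_ : row j v = v) //; apply/rowP => c; rewrite mxE ord1.
have : (M < M + v)%MS.
  by rewrite ltmxE addsmxSl /= addsmx_sub submx_refl (negbTE vM).
rewrite ltmxErank => /andP[_]; rewrite (eqP freeM) addsmxE => ltk.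
by rewrite /row_free eqn_leq rank_leq_row (leq_trans _ ltk) ?addn1.
Qed.

Section BorderPower.
Variables (F : fieldType) (X Y Z : finType).
Hypothesis Finf : infinite_field F.
Local Notation V := (X * Y * Z)%type.

(** The values at [S] of all monomials with exponents at most [n], arranged so that a linear
    functional of this row is a polynomial in the entries of [S]. *)
Definition monomials n (S : V -> F) : 'rV[F]_#|{: {ffun V -> 'I_n.+1}}| :=
  \row_j \prod_v S v ^+ (enum_val j : {ffun V -> 'I_n.+1}) v.

(** Grouping equal positions gives a monomial in which the exponent of [v] counts the indices sent
    to [v], hence is at most [n]. *)
Lemma prod_monomials n (t : 'I_n -> V) :
  exists j, forall S, \prod_i S (t i) = monomials n S 0 j.
Proof.
exists (enum_rank [ffun v => inord #|[set i | t i == v]| ]) => S.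
rewrite mxE enum_rankK (partition_big t predT) //=; apply: eq_bigr => v _.
rewrite (eq_bigr (fun=> S v)) => [|i /eqP -> //].
rewrite prodr_const ffunE inordK ?ltnS; first by rewrite cardsE.
by rewrite (leq_trans (max_card _)) // card_ord.
Qed.

(* A linear functional vanishing on the monomial vectors of all tensors of rank at
   most [r] is a polynomial vanishing on these tensors. *)
Lemma border_monomials n (T : V -> F) r k
    (M : 'M[F]_(k, #|{: {ffun V -> 'I_n.+1}}|)) : border_rank_le T r ->
  (forall S : V -> F, rank_le S r -> (monomials n S <= M)%MS) ->
  (monomials n T <= M)%MS.
Proof.
move=> Tr HM; rewrite submxE; apply/eqP/rowP => j; rewrite [RHS]mxE.
(* [border_rank_le] speaks of every algebraically closed extension, so one has to be supplied before
   it can be used. *)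
have [[L phi]] := closed_extension F.
pose c i := cokermx M i j.
have cE S : (monomials n S *m cokermx M) 0 j =
    \sum_i c i * \prod_v S v ^+ (enum_val i : {ffun V -> 'I_n.+1}) v.
  by rewrite mxE; apply: eq_bigr => i _; rewrite mxE mulrC.
pose p : mpoly.mpoly #|{: V}| L := \sum_i mpoly.mpolyC _ (phi (c i)) *
  \prod_(l < #|{: V}|) (mpoly.mpolyX L (mpoly.mnm1 l)) ^+
    (enum_val i : {ffun V -> 'I_n.+1}) (enum_val l).
have pE (S : V -> F) : mpoly.meval (fun l => phi (S (enum_val l))) p =
    phi ((monomials n S *m cokermx M) 0 j).
  rewrite cE !rmorph_sum; apply: eq_bigr => i _; rewrite !rmorphM /= mpoly.mevalC.
  congr (_ * _); rewrite !rmorph_prod.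
  rewrite [RHS](reindex _ (onW_bij _ (enum_val_bij V))) /=; apply: eq_bigr => l _.
  by rewrite !rmorphXn /= mpoly.mevalXU.
apply: (fmorph_inj phi); rewrite rmorph0 -pE; apply: Tr.
apply: (vanish_transfer Finf (phi := phi)) => S /HM.
by rewrite pE submxE => /eqP ->; rewrite mxE rmorph0.
Qed.

(** Every entry of the [n]-th power of [T] is a coordinate of [monomials n T]. Writing this row as a
    combination of rows [monomials n (S i)] with [S i] of rank at most [r] therefore writes the
    power of [T] as a combination of powers of the [S i]. *)
Lemma border_rank_pow (T : V -> F) r n : border_rank_le T r ->
  rank_le (fun t : {ffun 'I_n -> X} * {ffun 'I_n -> Y} * {ffun 'I_n -> Z} =>
    \prod_i T (t.1.1 i, t.1.2 i, t.2 i)) (n.+1 ^ #|{: V}| * r ^ n).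
Proof.
move=> Tr.
have [k [M [kN MA spanM]]] := finite_row_span
  [set v | exists2 S : V -> F, rank_le S r & v = monomials n S]%classic.
have [|a TE] := submxP (border_monomials (M := M) Tr _).
  by move=> S Sr; apply: spanM; exists S.
pose S i := projT1 (cid2 (MA i)).
have Sr i : rank_le (S i) r by rewrite /S; case: cid2.
have ME i : row i M = monomials n (S i) by rewrite /S; case: cid2.
have := rank_le_sum (fun i => rank_leZ (a 0 i) (rank_le_pow n (Sr i))).
rewrite card_ffun card_ord in kN.
move/(rank_le_trans (leq_mul kN (leqnn _))) => [u [v [w E]]].
exists u, v, w => t; rewrite -E.
have [j jP] := prod_monomials (fun i => (t.1.1 i, t.1.2 i, t.2 i)).
rewrite jP TE mxE; apply: eq_bigr => i _; congr (_ * _).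
by rewrite jP -ME mxE.
Qed.

Lemma bRsP (Phi : {set V}) :
  exists T : V -> F, Defs.support T = Phi /\ border_rank_le T (bRs F Phi).
Proof. by rewrite /bRs; case: ex_minnP => m /asboolP. Qed.

Lemma Rs_supp_pow_le (Phi : {set V}) n :
  (Rs F (supp_pow Phi n) <= n.+1 ^ #|{: V}| * bRs F Phi ^ n)%N.
Proof.
have [T [<- Tr]] := bRsP Phi; apply/Rs_leP.
eexists; split; last exact: border_rank_pow Tr.
apply/setP => t; rewrite !inE; apply/prodf_neq0/forallP => H i.
  by rewrite inE; exact: H.
by move=> _; have := H i; rewrite inE.
Qed.

Lemma bRs_le_Rs (Phi : {set V}) : (bRs F Phi <= Rs F Phi)%N.
Proof.
rewrite /bRs; case: ex_minnP => m _; apply.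
have [T [TPhi rT]] := RsP F Phi; apply/asboolP; exists T; split => //.
exact: rank_le_border.
Qed.

End BorderPower.

(** * Subadditive sequences and convergence of the exponents *)

Section Fekete.
Local Open Scope classical_set_scope.
Variable R : realType.

Section Subadditive.
Variable v : nat -> R.
Hypotheses (v_ge0 : forall n, 0 <= v n).
Hypothesis v_sub : forall m n, v (m + n)%N <= v m + v n.

Lemma subadditive_mul q m r : v (q * m + r)%N <= q%:R * v m + v r.
Proof.
elim: q => [|q IH]; first by rewrite mul0n add0n mul0r add0r.
rewrite mulSn -addnA (le_trans (v_sub _ _)) // -natr1.
by have := IH; lra.
Qed.

(** The limit is the infimum of [v n / n] over positive [n], which gives the second assertion. For
    convergence, [n] is divided with remainder by an [m] that nearly attains the infimum. *)
Lemma fekete : exists l : R,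
  (fun n => n%:R^-1 * v n) @ \oo --> l /\ forall n, n%:R * l <= v n.
Proof.
pose S := [set x | exists2 n, (0 < n)%N & x = v n / n%:R]%classic.
have S0 : S !=set0 by exists (v 1%N / 1), 1%N.
have Slb : has_lbound S.
  by exists 0 => _ [n n0 ->]; rewrite divr_ge0.
have Sinf : has_inf S by split.
exists (inf S); split; last first.
  case=> [|n]; first by rewrite mul0r.
  by rewrite -ler_pdivlMl // mulrC; apply: ge_inf => //; exists n.+1.
apply/cvgrPdist_le => e e0.
have e2 : 0 < e / 2 by rewrite divr_gt0.
have [_ [m m0 ->] Hm] := inf_adherent e2 Sinf.
pose B := \sum_(r < m) v r.
have B0 : 0 <= B by apply: sumr_ge0.
near=> n.
have n0 : (0 < n)%N by near: n; exact: nbhs_infty_gt.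
have nR : (0 : R) < n%:R by rewrite ltr0n.
have mR : (0 : R) < m%:R by rewrite ltr0n.
have low : inf S <= n%:R^-1 * v n.
  by apply: ge_inf => //; exists n; rewrite // mulrC.
have up : v n <= n%:R * (v m / m%:R) + B.
  rewrite {1}(divn_eq n m) (le_trans (subadditive_mul _ _ _)) // lerD //.
    rewrite mulrCA mulrC ler_wpM2l // ler_pdivlMr // -natrM ler_nat.
    exact: leq_trunc_div.
  rewrite /B (bigD1 (Ordinal (ltn_pmod n m0))) //= lerDl.
  exact: sumr_ge0.
have Bn : B <= n%:R * (e / 2).
  rewrite -ler_pdivrMr //; near: n; exact: nbhs_infty_ger.
rewrite distrC ger0_norm ?subr_ge0 // lerBlDr mulrC ler_pdivrMr //.
have := ler_wpM2l (ltW nR) (ltW Hm); lra.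
Unshelve. all: by end_near.
Qed.


End Subadditive.

(** Adding [C] to [u] makes it subadditive without changing the limit; [C] will account for rounded
    dimensions. *)
Lemma quasi_fekete (u : nat -> R) (C : R) :
  0 <= C -> (forall n, 0 <= u n) -> (forall m n, u (m + n)%N <= u m + u n + C) ->
  exists l : R, (fun n => n%:R^-1 * u n) @ \oo --> l /\ forall n, n%:R * l <= u n + C.
Proof.
move=> C0 u0 usub.
have [||l [cl lP]] := @fekete (fun n => u n + C).
- by move=> n; rewrite addr_ge0.
- by move=> m n; have := usub m n; lra.
exists l; split=> //.
rewrite (_ : (fun n => _) = (fun n => n%:R^-1 * (u n + C)) \- (fun n => n%:R^-1 * C)); last first.
  by apply/funext => n /=; ring.
rewrite -[l]subr0; apply: cvgB => //; rewrite -[X in _ --> X](mul0r C).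
apply: cvgMl; apply/gtr0_cvgV0; first by near=> n; rewrite ltr0n; near: n; exact: nbhs_infty_gt.
exact: cvgr_idn.
Unshelve. all: by end_near.
Qed.

End Fekete.

(** * Base 2 logarithms and rounded powers of 2 *)

Section Log2.
Variable R : realType.
Implicit Types x y : R.

Lemma ln2_gt0 : 0 < ln (2 : R).
Proof. by rewrite ln_gt0 // ltr1n. Qed.

Lemma log2M x y : 0 < x -> 0 < y -> log2 (x * y) = log2 x + log2 y.
Proof. by move=> x0 y0; rewrite /log2 lnM ?posrE // mulrDl. Qed.

Lemma ler_log2 x y : 0 < x -> x <= y -> log2 x <= log2 y.
Proof.
move=> x0 xy; rewrite /log2 ler_pM2r ?invr_gt0 ?ln2_gt0 // ler_ln ?posrE //.
exact: lt_le_trans xy.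
Qed.

Lemma log2_ge0 x : 1 <= x -> 0 <= log2 x.
Proof. by move=> x1; apply: divr_ge0; [exact: ln_ge0 | exact/ltW/ln2_gt0]. Qed.

Lemma log2_powR x : log2 ((2 : R) `^ x) = x.
Proof. by rewrite /log2 ln_powR mulfK // gt_eqF // ln2_gt0. Qed.

Lemma powR2_log2 x : 0 < x -> (2 : R) `^ (log2 x) = x.
Proof.
by move=> x0; rewrite /powR gt_eqF // divfK ?lnK // gt_eqF // ln2_gt0.
Qed.

Lemma log2_natX (r n : nat) : log2 ((r ^ n)%:R : R) = n%:R * log2 (r%:R).
Proof.
rewrite /log2 natrX; case: r => [|r]; last first.
  by rewrite lnXn ?ltr0n // -[ln _ *+ n]mulr_natl -mulrA.
by case: n => [|n]; rewrite ?expr0 ?ln1 ?expr0n /= ?(ln0 (lexx 0)) !mul0r ?mulr0.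
Qed.

Lemma log2_ge0_nat (n : nat) : 0 <= log2 (n%:R : R).
Proof. by case: n => [|n]; [rewrite /log2 ln0 // mul0r | rewrite log2_ge0 // ler1n]. Qed.

Lemma fl2_gt0 x : 0 <= x -> (0 < fl2 x)%N.
Proof. by move=> x0; rewrite truncn_gt0 -[leLHS](powRr0 2) ler_powR // ler1n. Qed.

Lemma fl2_le x : (fl2 x)%:R <= (2 : R) `^ x.
Proof. by rewrite truncn_le // powR_ge0. Qed.

Lemma fl2_lt x : 0 <= x -> (2 : R) `^ x <= 2 * (fl2 x)%:R.
Proof.
move=> x0; have := truncnS_gt ((2 : R) `^ x); rewrite -/(fl2 x) -natr1.
by have : (1 : R) <= (fl2 x)%:R by [rewrite ler1n fl2_gt0]; lra.
Qed.

(** Each of the two floors loses at most a factor 2, whence the 4. *)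
Lemma fl2_add x y : 0 <= x -> 0 <= y -> (fl2 (x + y) <= 4 * (fl2 x * fl2 y))%N.
Proof.
move=> x0 y0; rewrite -(ler_nat R) (le_trans (fl2_le _)) // powRD; last first.
  by rewrite pnatr_eq0 implybT.
rewrite (le_trans (ler_pM _ _ (fl2_lt x0) (fl2_lt y0))) ?powR_ge0 //.
by rewrite !natrM le_eqVlt; apply/orP; left; apply/eqP; ring.
Qed.

End Log2.

(** * Powers of supports and matrix multiplication supports *)

Section SupportOperations.
Variable F : fieldType.
Hypothesis Finf : infinite_field F.

Lemma Rs_supp_powD (X Y Z : finType) (Phi : {set X * Y * Z}) m n :
  (Rs F (supp_pow Phi (m + n)) <= Rs F (supp_pow Phi m) * Rs F (supp_pow Phi n))%N.
Proof.
pose glue (A : finType) (p : {ffun 'I_m -> A} * {ffun 'I_n -> A}) :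
  {ffun 'I_(m + n) -> A} :=
  [ffun i => match fintype.split i with inl j => p.1 j | inr j => p.2 j end].
apply: leq_trans (Rs_prod F _ _).
apply: (Rs_image_eq Finf (f := @glue X) (g := @glue Y) (h := @glue Z)).
  move=> t; rewrite !inE => /andP[/forallP H /forallP H']; apply/forallP => i /=.
  by rewrite !ffunE; case: (fintype.split i) => j; [exact: H | exact: H'].
move=> [[x y] z]; rewrite inE => /forallP /= H.
pose lft (A : finType) (x : {ffun 'I_(m + n) -> A}) := [ffun j => x (lshift n j)].
pose rgt (A : finType) (x : {ffun 'I_(m + n) -> A}) := [ffun j => x (rshift m j)].
have glueK (A : finType) (a : {ffun 'I_(m + n) -> A}) : glue A (lft A a, rgt A a) = a.
  by apply/ffunP => i; rewrite ffunE; case: split_ordP => j ->; rewrite ffunE.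
exists ((lft X x, rgt X x), (lft Y y, rgt Y y), (lft Z z, rgt Z z)).
  by rewrite !inE; apply/andP; split; apply/forallP => i; rewrite !ffunE; exact: H.
by rewrite /= !glueK.
Qed.

Lemma supp_pow_neq0 (X Y Z : finType) (Phi : {set X * Y * Z}) n :
  Phi != finset.set0 -> supp_pow Phi n != finset.set0.
Proof.
move=> /set0Pn[[[x y] z] tPhi]; apply/set0Pn.
exists ([ffun=> x], [ffun=> y], [ffun=> z]); rewrite inE; apply/forallP => i.
by rewrite !ffunE.
Qed.

Lemma mem_brak (I J K : finType) (Lam : {set I * J * K}) t :
  (t \in brak Lam) = [&& t.1.1.2 == t.1.2.1, t.1.2.2 == t.2.1, t.2.2 == t.1.1.1 &
    (t.1.1.1, t.1.1.2, t.1.2.2) \in Lam].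
Proof.
apply/imsetP/and4P => [[[[i j] k] L ->]|]; first by [].
case: t => [[[i j] [j' k]] [k' i']] /= [/eqP -> /eqP -> /eqP -> L].
by exists (i, j', k').
Qed.

Lemma Rs_brak_prod (I J K I' J' K' : finType) :
  (Rs F (brak [set: (I * I') * (J * J') * (K * K')])
   <= Rs F (brak [set: I * J * K]) * Rs F (brak [set: I' * J' * K']))%N.
Proof.
apply: leq_trans (Rs_prod F _ _).
pose sw (A A' B B' : finType) (p : (A * B) * (A' * B')) : (A * A') * (B * B') :=
  ((p.1.1, p.2.1), (p.1.2, p.2.2)).
apply: (Rs_image_eq Finf (f := @sw I I' J J') (g := @sw J J' K K') (h := @sw K K' I I')).
  move=> [[[[i j] [i' j']] [[j1 k] [j1' k']]] [[k1 i1] [k1' i1']]].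
  rewrite !inE !mem_brak /= !inE !andbT.
  by move=> /andP[/and3P[/eqP-> /eqP-> /eqP->] /and3P[/eqP-> /eqP-> /eqP->]]; rewrite !eqxx.
move=> [[[[i i'] [j j']] [[j1 j1'] [k k']]] [[k1 k1'] [i1 i1']]].
rewrite mem_brak /= inE andbT => /and3P[/eqP[<- <-] /eqP[<- <-] /eqP[-> ->]].
by exists (((i, j), (i', j')), ((j, k), (j', k')), ((k, i), (k', i')));
  rewrite // inE !mem_brak /= !inE !eqxx.
Qed.

Lemma Rs_brak_cyc (I J K : finType) :
  (Rs F (brak [set: J * K * I]) <= Rs F (brak [set: I * J * K]))%N.
Proof.
have [T [TE [u [v [w E]]]]] := RsP F (brak [set: I * J * K]).
apply/Rs_leP; exists (fun t => T (t.2, t.1.1, t.1.2)); split.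
  apply/setP => t; rewrite inE.
  have /setP/(_ (t.2, t.1.1, t.1.2)) := TE; rewrite inE => ->.
  rewrite !mem_brak /= !inE !andbT.
  by rewrite andbC -andbA.
by exists v, w, u => t; rewrite E; apply: eq_bigr => l _ /=; ring.
Qed.

Lemma ord_surj (T : finType) m : (0 < m <= #|T|)%N ->
  exists (f : T -> 'I_m) (g : 'I_m -> T), cancel g f.
Proof.
case: m => // m /= mT.
exists (fun x => inord (enum_rank x)), (fun i => enum_val (widen_ord mT i)) => i.
by rewrite enum_valK inord_val.
Qed.

(** The larger index sets map onto the smaller ones, and merging variables along these surjections
    carries the larger support onto the smaller. *)
Lemma Rs_mm_supp (I J K : finType) l m n :
  (l <= #|I|)%N -> (m <= #|J|)%N -> (n <= #|K|)%N ->
  (Rs F (mm_supp l m n) <= Rs F (brak [set: I * J * K]))%N.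
Proof.
move=> lI mJ nK.
(* If some dimension is 0, a surjection may fail to exist, but then the support is empty and has
   support rank 0. *)
have [->|] := eqVneq (mm_supp l m n) finset.set0; first by rewrite Rs0.
move=> /set0Pn[_ /imsetP[[[i0 j0] k0] _ _]].
have ord0 q (i : 'I_q) : (0 < q)%N by apply: leq_ltn_trans (ltn_ord i).
have [|f [f' fK]] := @ord_surj I l; first by rewrite lI (ord0 _ i0).
have [|g [g' gK]] := @ord_surj J m; first by rewrite mJ (ord0 _ j0).
have [|h [h' hK]] := @ord_surj K n; first by rewrite nK (ord0 _ k0).
apply: (Rs_image_eq Finf (f := fun p => (f p.1, g p.2)) (g := fun p => (g p.1, h p.2))
  (h := fun p => (h p.1, f p.2))).
  move=> [[[i j] [j' k]] [k' i']]; rewrite !mem_brak /= !inE !andbT.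
  by move=> /and3P[/eqP-> /eqP-> /eqP->]; rewrite !eqxx.
move=> [[[i j] [j' k]] [k' i']]; rewrite mem_brak /= inE andbT.
move=> /and3P[/eqP<- /eqP<- /eqP->].
exists ((f' i, g' j), (g' j, h' k), (h' k, f' i)); first by rewrite mem_brak /= inE !eqxx.
by rewrite /= fK gK hK.
Qed.

Lemma mm_supp_neq0 l m n : (0 < l)%N -> (0 < m)%N -> (0 < n)%N ->
  mm_supp l m n != finset.set0.
Proof.
move=> l0 m0 n0; apply/set0Pn.
exists ((Ordinal l0, Ordinal m0), (Ordinal m0, Ordinal n0), (Ordinal n0, Ordinal l0)).
by rewrite mem_brak inE /= ?eqxx.
Qed.

End SupportOperations.

(** * Existence of the limits defining the exponents *)

Section Exponents.
Local Open Scope classical_set_scope.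
Variables (R : realType) (F : fieldType).
Hypothesis Finf : infinite_field F.

(** [aRs] is a [limn], which is informative only for a convergent sequence; submultiplicativity of
    the support rank of powers makes Fekete's lemma applicable to the logarithms. *)
Lemma aRs_cvg (X Y Z : finType) (Phi : {set X * Y * Z}) : Phi != finset.set0 ->
  (fun n => n%:R^-1 * log2 ((Rs F (supp_pow Phi n))%:R : R)) @ \oo -->
    log2 (aRs R F Phi).
Proof.
move=> Phi0.
have Rs0 n : (0 : R) < (Rs F (supp_pow Phi n))%:R.
  by rewrite ltr0n Rs_gt0 // supp_pow_neq0.
pose u n := log2 ((Rs F (supp_pow Phi n))%:R : R).
have [//|n|m n|l [cl _]] := @quasi_fekete R u 0; first exact: log2_ge0_nat.
  rewrite addr0 -log2M // -natrM ler_log2 // ler_nat; exact: Rs_supp_powD.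
suff -> : aRs R F Phi = expR (l * ln 2).
  by rewrite /log2 expRK mulfK // gt_eqF // ln2_gt0.
apply: cvg_lim => //.
rewrite (_ : (fun n => _) = (fun n => expR (n%:R^-1 * u n * ln 2))); last first.
  apply/funext => n; rewrite /powR gt_eqF // /u /log2 -mulrA divfK //.
  by rewrite gt_eqF // ln2_gt0.
apply: (@continuous_cvg _ _ _ _ _ _ expR); first exact: continuous_expR.
exact: cvgMl.
Qed.

Definition mm_log (a b c : R) (n : nat) : R :=
  log2 (Rs F (mm_supp (fl2 (a * n%:R)) (fl2 (b * n%:R)) (fl2 (c * n%:R))))%:R.

Lemma Rs_fl2_gt0 (x y z : R) : 0 <= x -> 0 <= y -> 0 <= z ->
  (0 < Rs F (mm_supp (fl2 x) (fl2 y) (fl2 z)))%N.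
Proof. by move=> x0 y0 z0; rewrite Rs_gt0 // mm_supp_neq0 // fl2_gt0. Qed.

(** The bound valid at every [n] is recorded too, for later use at an index that is itself a rounded
    multiple of another. *)
Lemma omega_s_cvg (a b c : R) : 0 <= a -> 0 <= b -> 0 <= c ->
  (fun n => n%:R^-1 * mm_log a b c n) @ \oo --> omega_s F a b c /\
  exists C, forall n, n%:R * omega_s F a b c <= mm_log a b c n + C.
Proof.
move=> a0 b0 c0.
pose C : R := log2 (Rs F (mm_supp 4 4 4))%:R.
have [|n|m n|l [cl lP]] := @quasi_fekete R (mm_log a b c) C.
- exact: log2_ge0_nat.
- exact: log2_ge0_nat.
- rewrite /mm_log /C -log2M ?ltr0n ?Rs_fl2_gt0 ?mulr_ge0 //.
  rewrite -log2M ?mulr_gt0 ?ltr0n ?Rs_fl2_gt0 ?mulr_ge0 ?Rs_gt0 ?mm_supp_neq0 //.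
  rewrite -!natrM ler_log2 ?ltr0n ?Rs_fl2_gt0 ?mulr_ge0 // ler_nat natrD !mulrDr.
  rewrite mulnC (leq_trans _ (leq_mul (leqnn _) (Rs_brak_prod Finf _ _ _ _ _ _))) //.
  rewrite (leq_trans _ (Rs_brak_prod Finf _ _ _ _ _ _)) //.
  by apply: Rs_mm_supp => //; rewrite !card_prod !card_ord fl2_add ?mulr_ge0.
suff -> : omega_s F a b c = l by split=> //; exists C.
exact: cvg_lim cl.
Qed.

End Exponents.

(** * Random covering *)

Section Covering.
Variable R : realType.

(** Cauchy-Schwarz on the set where [N] is nonzero, obtained by expanding a nonnegative sum of
    squares. *)
Lemma second_moment (T : finType) (N : T -> R) M : 0 < M ->
  \sum_x N x ^+ 2 <= M -> (\sum_x N x) ^+ 2 / M <= #|[set x | N x != 0]|%:R.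
Proof.
move=> M0 NM; set mu := \sum_x N x; set S := [set x | N x != 0].
have H : 0 <= \sum_x ((N x != 0)%:R - mu / M * N x) ^+ 2.
  by apply: sumr_ge0 => x _; exact: sqr_ge0.
have E : \sum_x ((N x != 0)%:R - mu / M * N x) ^+ 2 =
    #|S|%:R - 2 * (mu / M) * mu + (mu / M) ^+ 2 * \sum_x N x ^+ 2.
  rewrite -sum1_card natr_sum !mulr_sumr (big_mkcond (fun x => x \in S)) -sumrB -big_split.
  apply: eq_bigr => x _ /=; rewrite inE.
  by have [->|_] := eqVneq (N x) 0; rewrite /=; ring.
have : (mu / M) ^+ 2 * \sum_x N x ^+ 2 <= (mu / M) ^+ 2 * M by rewrite ler_wpM2l ?sqr_ge0.
have -> : (mu / M) ^+ 2 * M = mu ^+ 2 / M by field; rewrite gt_eqF.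
have E2 : (mu / M) * mu = mu ^+ 2 / M by field; rewrite gt_eqF.
by move: H; rewrite E -mulrA E2; lra.
Qed.

(** Two distinct points both take the value [a] under a fraction [A ^- 2] of the maps, a single
    point under a fraction [A^-1]; the last power unites the two cases. *)
Lemma random_map_pair (U : finType) A (x y : U) (a : 'I_A) :
  \sum_(f : {ffun U -> 'I_A}) ((f x == a)%:R * (f y == a)%:R : R) =
  #|{: {ffun U -> 'I_A}}|%:R * (A%:R ^- 2 * A%:R ^+ (x == y)).
Proof.
have A0 : A%:R != 0 :> R.
  by rewrite pnatr_eq0 -lt0n; apply: leq_ltn_trans (ltn_ord a).
pose G (z : U) (i : 'I_A) : R := ((z \in [set x; y]) ==> (i == a))%:R.
transitivity (\sum_(f : {ffun U -> 'I_A}) \prod_z G z (f z)).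
  apply: eq_bigr => f _; rewrite -natrM mulnb.
  have [/andP[/eqP fx /eqP fy]|nf] := boolP ((f x == a) && _).
    rewrite big1 // => z _; rewrite /G !inE.
    by case: eqP => [->|_]; rewrite ?fx ?eqxx //; case: eqP => [->|//]; rewrite fy eqxx.
  case/nandP: nf => /negbTE nf.
    by rewrite (bigD1 x) //= /G !inE eqxx nf /= mul0r.
  by rewrite (bigD1 y) //= /G !inE eqxx orbT nf /= mul0r.
rewrite -bigA_distr_bigA /=.
have GE z : \sum_i G z i = A%:R * (if z \in [set x; y] then A%:R^-1 else 1).
  rewrite /G; case: ifP => zxy /=.
    by rewrite mulfV // (bigD1 a) //= eqxx big1 ?addr0 // => i /negbTE ->.
  by rewrite sumr_const card_ord mulr1.
under eq_bigr do rewrite GE.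
rewrite big_split /= prodr_const card_ffun card_ord natrX -big_mkcond /= prodr_const cards2.
congr (_ * _); have [_|_] := eqVneq x y => /=; last by rewrite expr0 mulr1 exprVn.
by rewrite !expr1; field.
Qed.

Section RandomTriple.
Variables (T U V W : finType) (p1 : T -> U) (p2 : T -> V) (p3 : T -> W).
Variables (A B C : nat) (Q : T -> R).

Local Notation maps := ({ffun U -> 'I_A} * {ffun V -> 'I_B} * {ffun W -> 'I_C})%type.

Definition covers (w : maps) (c : 'I_A * 'I_B * 'I_C) : bool :=
  [exists t, [&& Q t != 0, w.1.1 (p1 t) == c.1.1, w.1.2 (p2 t) == c.1.2
               & w.2 (p3 t) == c.2]].

(** Second moment method for the [Q]-mass [N w] of the elements that [w] sends to [c]. Its mean is
    the mass of [Q] divided by [D = ABC], its mean square is at most [kappa / D ^ 2], and [D]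
    cancels in the quotient. *)
Lemma cover_fraction kappa c : 0 < kappa ->
  \sum_t \sum_t' Q t * Q t' * (A%:R ^+ (p1 t == p1 t') * B%:R ^+ (p2 t == p2 t') *
    C%:R ^+ (p3 t == p3 t')) <= kappa ->
  (\sum_t Q t) ^+ 2 / kappa * #|{: maps}|%:R <= #|[set w | covers w c]|%:R.
Proof.
move=> kappa0 Hk; case: c => [[a b] c].
have pos q (i : 'I_q) : q%:R != 0 :> R.
  by rewrite pnatr_eq0 -lt0n; apply: leq_ltn_trans (ltn_ord i).
have pos' q (i : 'I_q) : (0 : R) < q%:R by rewrite lt0r pos //= ler0n.
pose N (w : maps) := \sum_t Q t *
  ((w.1.1 (p1 t) == a)%:R * (w.1.2 (p2 t) == b)%:R * (w.2 (p3 t) == c)%:R).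
pose D : R := A%:R * B%:R * C%:R.
have D0 : 0 < D by rewrite /D !mulr_gt0 // pos'.
have om0 : (0 : R) < #|{: maps}|%:R.
  rewrite ltr0n; apply/card_gt0P.
  by exists ([ffun=> a], [ffun=> b], [ffun=> c]).
have pairE t t' : \sum_(w : maps)
   ((w.1.1 (p1 t) == a)%:R * (w.1.2 (p2 t) == b)%:R * (w.2 (p3 t) == c)%:R) *
   ((w.1.1 (p1 t') == a)%:R * (w.1.2 (p2 t') == b)%:R * (w.2 (p3 t') == c)%:R) =
   #|{: maps}|%:R * (D ^- 2 * (A%:R ^+ (p1 t == p1 t') * B%:R ^+ (p2 t == p2 t') *
    C%:R ^+ (p3 t == p3 t'))) :> R.
  transitivity ((\sum_(f : {ffun U -> 'I_A}) ((f (p1 t) == a)%:R * (f (p1 t') == a)%:R : R)) *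
    (\sum_(f : {ffun V -> 'I_B}) ((f (p2 t) == b)%:R * (f (p2 t') == b)%:R : R)) *
    (\sum_(f : {ffun W -> 'I_C}) ((f (p3 t) == c)%:R * (f (p3 t') == c)%:R : R))).
    rewrite big_distrlr /= pair_big /= big_distrlr /= pair_big /=.
    by apply: eq_bigr => -[[f g] h] _ /=; ring.
  rewrite !random_map_pair !card_prod !natrM /D.
  by field; rewrite !pos.
have N2 : \sum_w N w ^+ 2 <= #|{: maps}|%:R * (D ^- 2 * kappa).
  apply: (@le_trans _ _ (#|{: maps}|%:R * (D ^- 2 * \sum_t \sum_t' Q t * Q t' *
    (A%:R ^+ (p1 t == p1 t') * B%:R ^+ (p2 t == p2 t') * C%:R ^+ (p3 t == p3 t'))))).
    rewrite !mulr_sumr; under eq_bigr do rewrite expr2 big_distrlr /=.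
    rewrite exchange_big /=; apply: ler_sum => t _.
    rewrite exchange_big /= !mulr_sumr; apply: ler_sum => t' _.
    rewrite le_eqVlt; apply/orP; left; apply/eqP.
    under eq_bigr do rewrite mulrACA.
    by rewrite -mulr_sumr pairE; ring.
  by rewrite ler_pM2l // ler_pM2l // invr_gt0 exprn_gt0.
have N1 : \sum_w N w = #|{: maps}|%:R * (D^-1 * \sum_t Q t).
  rewrite exchange_big !mulr_sumr /=; apply: eq_bigr => t _.
  have := pairE t t; rewrite !eqxx !expr1 -/D => pE.
  transitivity (Q t * \sum_(w : maps)
   ((w.1.1 (p1 t) == a)%:R * (w.1.2 (p2 t) == b)%:R * (w.2 (p3 t) == c)%:R) *
   ((w.1.1 (p1 t) == a)%:R * (w.1.2 (p2 t) == b)%:R * (w.2 (p3 t) == c)%:R)).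
    rewrite mulr_sumr; apply: eq_bigr => w _.
    by rewrite -!natrM !mulnb andbb.
  by rewrite pE; field; rewrite gt_eqF.
have M0 : 0 < #|{: maps}|%:R * (D ^- 2 * kappa).
  by rewrite !mulr_gt0 // invr_gt0 exprn_gt0.
have := second_moment M0 N2; rewrite N1.
set om : R := #|{: maps}|%:R.
have -> : (om * (D^-1 * \sum_t Q t)) ^+ 2 / (om * (D ^- 2 * kappa)) =
    (\sum_t Q t) ^+ 2 / kappa * om.
  by field; rewrite !gt_eqF.
move/le_trans; apply; rewrite ler_nat; apply/subset_leq_card/fintype.subsetP => w.
rewrite !inE; apply: contraNT => /existsPn Hw; apply/eqP/big1 => t _.
have := Hw t; rewrite !negb_and negbK.
by case/or4P => [/eqP->|/negbTE->|/negbTE->|/negbTE->]; rewrite ?mul0r ?mulr0 ?mul0r ?mulr0.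
Qed.

End RandomTriple.

(** On average over [O], a member covers at least a fraction [eps] of the targets still uncovered,
    so some member reduces their number by the factor [1 - eps]. *)
Lemma greedy_cover (O T : finType) (cov : O -> T -> bool) (eps : R) (o0 : O) :
  eps <= 1 -> (forall t, eps * #|O|%:R <= #|[set w | cov w t]|%:R) ->
  forall m, exists s : seq O, size s = m /\
    #|[set t | ~~ has (cov^~ t) s]|%:R <= (1 - eps) ^+ m * #|T|%:R.
Proof.
move=> eps1 Hcov; elim=> [|m [s [sm Hs]]].
  by exists [::]; rewrite expr0 mul1r ler_nat max_card.
pose S := [set t | ~~ has (cov^~ t) s].
pose rest w := [set t | ~~ has (cov^~ t) (w :: s)].
have O0 : (0 : R) < #|O|%:R by rewrite ltr0n; apply/card_gt0P; exists o0.
have sumE : \sum_w #|rest w|%:R <= \sum_(w : O) (1 - eps) * #|S|%:R :> R.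
  have -> : \sum_w #|rest w|%:R = \sum_(t in S) #|[set w | ~~ cov w t]|%:R :> R.
    under eq_bigr do rewrite -sum1_card natr_sum.
    under [RHS]eq_bigr do rewrite -sum1_card natr_sum.
    rewrite (exchange_big_dep (fun t => t \in S)) /=; last first.
      by move=> w t _; rewrite !inE /= negb_or => /andP[].
    apply: eq_bigr => t; rewrite inE => tS; apply: eq_bigl => w.
    by rewrite !inE /= negb_or tS andbT.
  have -> : \sum_(w : O) (1 - eps) * #|S|%:R = \sum_(t in S) (1 - eps) * #|O|%:R.
    by rewrite !sumr_const -![(_ * _) *+ _]mulr_natr mulrAC.
  apply: ler_sum => t _; have := Hcov t.
  have := cardsC [set w | cov w t].
  rewrite (_ : ~: _ = [set w | ~~ cov w t]); last by apply/setP => w; rewrite !inE.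
  move/(congr1 (fun n => n%:R : R)); rewrite natrD => <-; set x := #|_|%:R; set y := #|_|%:R.
  by lra.
have [w Hw] : exists w, #|rest w|%:R <= (1 - eps) * #|S|%:R :> R.
  apply: contrapT => Hn; suff : \sum_(w : O) (1 - eps) * #|S|%:R < \sum_w #|rest w|%:R :> R.
    by rewrite ltNge sumE.
  rewrite (bigD1 o0) // [X in _ < X](bigD1 o0) //=; apply: ltr_leD.
    by rewrite ltNge; apply/negP => H; apply: Hn; exists o0.
  apply: ler_sum => w _; apply/ltW; rewrite ltNge; apply/negP => H; apply: Hn; by exists w.
exists (w :: s); split; first by rewrite /= sm.
rewrite (le_trans Hw) // exprS -mulrA ler_wpM2l // subr_ge0 //.
Qed.

Lemma greedy_cover_all (O T : finType) (cov : O -> T -> bool) (eps h : R) (o0 : O) :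
  0 < eps -> eps <= 1 -> 0 <= h -> #|T|%:R <= expR h ->
  (forall t, eps * #|O|%:R <= #|[set w | cov w t]|%:R) ->
  exists s : seq O, (size s)%:R <= h / eps + 1 /\ forall t, has (cov^~ t) s.
Proof.
move=> eps0 eps1 h0 Th Hcov.
(* As [m > h / eps], at most [exp (h - eps m) < 1] targets stay uncovered, that is, none. *)
pose m := (Num.truncn (h / eps)).+1.
have [s [sm Hs]] := greedy_cover o0 eps1 Hcov m.
exists s; split.
  by rewrite sm /m -natr1 lerD2r truncn_le // divr_ge0 // ltW.
suff : (#|[set t | ~~ has (cov^~ t) s]| < 1)%N.
  by rewrite ltnS leqn0 cards_eq0 => /eqP/setP E t; have := E t; rewrite !inE => /negbFE.
rewrite -(ltr_nat R) (le_lt_trans Hs) //.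
have Hm : h < eps * m%:R by rewrite mulrC -ltr_pdivrMr // /m truncnS_gt.
apply: (@le_lt_trans _ _ (expR (- eps) ^+ m * expR h)).
  apply: ler_pM => //; first by rewrite exprn_ge0 // subr_ge0.
  by rewrite lerXn2r ?nnegrE ?subr_ge0 ?expR_ge0 // expR_ge1Dx.
rewrite -expRM_natl -expRD expR_lt1; move: Hm; rewrite mulrC; lra.
Qed.

End Covering.

(** * Typical sequences *)

Section TypicalSequences.
Local Open Scope classical_set_scope.
Variables (R : realType) (T : finType) (P : T -> R).
Hypotheses (P_ge0 : forall x, 0 <= P x) (P_sum : \sum_x P x = 1).

Definition iid n (t : {ffun 'I_n -> T}) : R := \prod_i P (t i).

Lemma iid_ge0 n (t : {ffun 'I_n -> T}) : 0 <= iid t.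
Proof. exact: prodr_ge0. Qed.

Lemma sum_iid n : \sum_(t : {ffun 'I_n -> T}) iid t = 1.
Proof.
by rewrite -(bigA_distr_bigA (fun (_ : 'I_n) x => P x)) big1.
Qed.

(** [Y] has mean 0 and the coordinates are independent, so only the diagonal terms of the expanded
    square survive. *)
Lemma variance_iid n (Y : T -> R) : \sum_x P x * Y x = 0 ->
  \sum_(t : {ffun 'I_n -> T}) iid t * (\sum_i Y (t i)) ^+ 2 =
  n%:R * \sum_x P x * Y x ^+ 2.
Proof.
move=> Y0.
transitivity (\sum_(i : 'I_n) \sum_(j : 'I_n) \sum_(t : {ffun 'I_n -> T})
    iid t * (Y (t i) * Y (t j))).
  under eq_bigr do rewrite expr2 big_distrlr /= mulr_sumr.
  rewrite exchange_big /=; apply: eq_bigr => i _.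
  by under eq_bigr do rewrite mulr_sumr; rewrite exchange_big.
rewrite (_ : n%:R * _ = \sum_(i < n) \sum_x P x * Y x ^+ 2); last first.
  by rewrite sumr_const card_ord mulr_natl.
apply: eq_bigr => i _.
pose G (i j k : 'I_n) x := P x * ((if k == i then Y x else 1) * (if k == j then Y x else 1)).
have GE j : \sum_(t : {ffun 'I_n -> T}) iid t * (Y (t i) * Y (t j)) =
    \prod_k \sum_x G i j k x.
  rewrite (bigA_distr_bigA (G i j)); apply: eq_bigr => t _.
  rewrite /G 2!big_split /=; congr (_ * (_ * _)).
    by rewrite -big_mkcond big_pred1_eq.
  by rewrite -big_mkcond big_pred1_eq.
rewrite (bigD1 i) //= [X in _ + X]big1 ?addr0 => [|j ji]; last first.
  rewrite GE (bigD1 i) //= /G eqxx eq_sym (negbTE ji).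
  by under eq_bigr do rewrite mulr1; rewrite Y0 mul0r.
rewrite GE (bigD1 i) //= [X in _ * X]big1 ?mulr1 => [|j ji]; last first.
  by rewrite /G (negbTE ji); under eq_bigr do rewrite !mulr1.
by rewrite /G eqxx; apply: eq_bigr => x _; rewrite expr2.
Qed.

Section Projection.
Variables (S : finType) (pi : T -> S).
Local Notation q := (marg pi P).

Lemma marg_ge0 s : 0 <= q s. Proof. exact: sumr_ge0. Qed.

Lemma marg_gt0 x : P x != 0 -> 0 < q (pi x).
Proof.
move=> Px; rewrite /marg (bigD1 x) //= ltr_wpDr ?sumr_ge0 // lt0r Px.
exact: P_ge0.
Qed.

Lemma marg_sum (f : S -> R) : \sum_s q s * f s = \sum_x P x * f (pi x).
Proof.
rewrite [RHS](partition_big pi predT) //=; apply: eq_bigr => s _.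
by rewrite mulr_suml; apply: eq_bigr => x /eqP ->.
Qed.

Lemma entropy_margE : entropy q = - \sum_x P x * log2 (q (pi x)).
Proof. by rewrite /entropy marg_sum. Qed.

Lemma sum_iid_fiber n (s : 'I_n -> S) :
  \sum_(t : {ffun 'I_n -> T} | [forall i, pi (t i) == s i]) iid t = \prod_i q (s i).
Proof.
rewrite /marg (bigA_distr_big_dep (fun i x => pi x == s i) (fun _ x => P x)).
by apply: eq_bigl => t.
Qed.

(** One-sided typicality: the upper bound on the probability of the projected sequence is what
    controls collisions. *)
Definition typical d n (t : {ffun 'I_n -> T}) : bool :=
  \prod_i q (pi (t i)) <= 2 `^ (- (n%:R * (entropy q - d))).

Let V := \sum_x P x * (log2 (q (pi x)) + entropy q) ^+ 2.

(** Chebyshev's inequality for the sum of the independent variables [log2 (q (pi (t i)))], each of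
    mean [- entropy q] and variance [V]. *)
Lemma atypical_le d n : 0 < d -> (0 < n)%N ->
  \sum_(t : {ffun 'I_n -> T} | ~~ typical d t) iid t <= V / (n%:R * d ^+ 2).
Proof.
move=> d0 n0; have nR : (0 : R) < n%:R by rewrite ltr0n.
pose Y x := log2 (q (pi x)) + entropy q.
have Y0 : \sum_x P x * Y x = 0.
  rewrite /Y; under eq_bigr do rewrite mulrDr.
  by rewrite big_split /= -mulr_suml P_sum mul1r entropy_margE addrN.
rewrite ler_pdivlMr ?mulr_gt0 ?exprn_gt0 //.
rewrite -(ler_pM2l nR) -(variance_iid n Y0) mulr_suml mulr_sumr big_mkcond /=.
apply: ler_sum => t _; case: ifP => [nt|_]; last by rewrite mulr_ge0 ?iid_ge0 ?sqr_ge0.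
(* Outside sequences of probability 0 every [q (pi (t i))] is positive, so the product is 2 to the
   sum of its logarithms. *)
have [->|tn0] := eqVneq (iid t) 0; first by rewrite !mul0r mulr0.
have qpos i : 0 < q (pi (t i)).
  apply: marg_gt0; apply: contraNneq tn0 => Pt.
  by rewrite /iid (bigD1 i) //= Pt mul0r.
rewrite mulrCA ler_wpM2l ?iid_ge0 // [leLHS](_ : _ = (n%:R * d) ^+ 2); last by ring.
have qE : \prod_i q (pi (t i)) = 2 `^ (\sum_i log2 (q (pi (t i)))).
  rewrite (big_morph (fun x => 2 `^ x) (id1 := 1) (op1 := *%R)) ?powRr0 //.
    by apply: eq_bigr => i _; rewrite powR2_log2.
  by move=> x y; rewrite powRD // pnatr_eq0 implybT.
move: nt; rewrite /typical qE -ltNge => lt.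
have {lt} : - (n%:R * (entropy q - d)) < \sum_i log2 (q (pi (t i))).
  rewrite ltNge; apply/negP => /(ler_powR (a := 2)) H.
  by move: lt; rewrite ltNge H // ler1n.
have -> : \sum_i Y (t i) = \sum_i log2 (q (pi (t i))) + n%:R * entropy q.
  by rewrite big_split /= sumr_const card_ord mulr_natl.
move=> lt; rewrite lerXn2r ?nnegrE ?mulr_ge0 ?(ltW nR) ?(ltW d0) //.
  by nra.
by lra.
Qed.

Lemma near_typical d e : 0 < d -> 0 < e ->
  \forall n \near \oo, \sum_(t : {ffun 'I_n -> T} | ~~ typical d t) iid t <= e.
Proof.
move=> d0 e0; near=> n.
have n0 : (0 < n)%N by near: n; exact: nbhs_infty_gt.
rewrite (le_trans (atypical_le d0 n0)) // invfM mulrCA mulrC ler_pdivrMr ?ltr0n //.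
rewrite -ler_pdivrMl //; near: n; exact: nbhs_infty_ger.
Unshelve. all: by end_near.
Qed.

(** For typical [t], the mass of the [t'] with the same projection is at most the probability of
    that projection, which typicality bounds; the total mass in [t] is at most 1. *)
Lemma collision_le d n (Q : {ffun 'I_n -> T} -> R) :
  (forall t, 0 <= Q t) -> (forall t, Q t <= iid t) ->
  (forall t, Q t != 0 -> typical d t) ->
  \sum_t \sum_t' Q t * Q t' * [forall i, pi (t i) == pi (t' i)]%:R
    <= 2 `^ (- (n%:R * (entropy q - d))).
Proof.
move=> Q0 QP Qtyp; set M := 2 `^ _.
apply: (@le_trans _ _ (\sum_t Q t * M)); last first.
  rewrite -mulr_suml -[leRHS]mul1r ler_wpM2r ?powR_ge0 // -(sum_iid n).
  exact: ler_sum.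
apply: ler_sum => t _.
have [->|/Qtyp tt] := eqVneq (Q t) 0.
  by rewrite mul0r big1 // => t' _; rewrite !mul0r.
under eq_bigr do rewrite -mulrA.
rewrite -mulr_sumr ler_wpM2l // (le_trans _ tt) // -(sum_iid_fiber (fun i => pi (t i))).
rewrite [leRHS]big_mkcond /=; apply: ler_sum => t' _.
rewrite (eq_forallb (fun i => eq_sym (pi (t i)) (pi (t' i)))).
by case: ifP; rewrite ?mulr1 ?mulr0.
Qed.

End Projection.

Lemma marg_id : marg id P = P.
Proof. by apply/funext => x; rewrite /marg big_pred1_eq. Qed.

End TypicalSequences.

(** * Matrix multiplication inside a power of the given support *)

Section Asymptotics.
Local Open Scope classical_set_scope.
Variable R : realType.

Lemma log2_sublinear (d : R) : 0 < d ->
  exists C, forall n, log2 (n.+1%:R : R) <= C + d * n%:R.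
Proof.
move=> d0; have dl : 0 < d * ln 2 by rewrite mulr_gt0 // ln2_gt0.
pose K : R := 1 + (d * ln 2)^-1.
have K0 : 0 < K by rewrite addr_gt0 // invr_gt0.
exists (log2 K) => n.
rewrite -[d * _]log2_powR -log2M ?powR_gt0 // ler_log2 // /powR pnatr_eq0 /=.
apply: (@le_trans _ _ (K * (1 + d * n%:R * ln 2))); last first.
  by rewrite ler_pM2l // expR_ge1Dx.
rewrite -natr1 /K mulrDl mul1r.
have -> : (d * ln 2)^-1 * (1 + d * n%:R * ln 2) = (d * ln 2)^-1 + n%:R.
  by field; rewrite !gt_eqF // ln2_gt0.
have : 0 < (d * ln 2)^-1 by rewrite invr_gt0.
have : 0 <= d * n%:R * ln 2 by rewrite !mulr_ge0 // ltW // ln2_gt0.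
by lra.
Qed.

(** Dividing by [n] removes the constant, and the remaining error [d] is arbitrary: factors growing
    slower than every exponential are lost in the limit. *)
Lemma le_lim_sublinear (u w : nat -> R) (l l' : R) :
  (fun n => n%:R^-1 * u n) @ \oo --> l -> (fun n => n%:R^-1 * w n) @ \oo --> l' ->
  (forall d, 0 < d -> exists C, \forall n \near \oo, u n <= w n + (C + d * n%:R)) ->
  l <= l'.
Proof.
move=> ul wl' H; apply/ler_addgt0Pr => d d0; have [C HC] := H d d0.
have Cl : (fun n : nat => n%:R^-1 * C) @ \oo --> (0 : R).
  rewrite -[X in _ --> X](mul0r C).
  apply: cvgMl; apply/gtr0_cvgV0; first by near=> n; rewrite ltr0n; near: n; exact: nbhs_infty_gt.
  exact: cvgr_idn.
have : (fun n => n%:R^-1 * w n + n%:R^-1 * C + d) @ \oo --> l' + 0 + d.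
  by apply: cvgD; [exact: cvgD | exact: cvg_cst].
rewrite addr0 => wl; apply: ler_cvg_to ul wl _.
near=> n; have n0 : (0 : R) < n%:R by rewrite ltr0n; near: n; exact: nbhs_infty_gt.
rewrite ler_pdivrMl // !mulrDr !mulVKf ?gt_eqF //.
have : u n <= w n + (C + d * n%:R) by near: n.
by lra.
Unshelve. all: by end_near.
Qed.

End Asymptotics.

(** * Covering the matrix multiplication support by images of a power *)

Section MatrixMultiplicationImage.
Variables (F : fieldType) (I J K : finType) (Lam : {set I * J * K}) (A B C n : nat).
Hypothesis Finf : infinite_field F.

Definition seqI (t : {ffun 'I_n -> I * J * K}) : {ffun 'I_n -> I} := [ffun i => (t i).1.1].
Definition seqJ (t : {ffun 'I_n -> I * J * K}) : {ffun 'I_n -> J} := [ffun i => (t i).1.2].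
Definition seqK (t : {ffun 'I_n -> I * J * K}) : {ffun 'I_n -> K} := [ffun i => (t i).2].

Local Notation maps := ({ffun {ffun 'I_n -> I} -> 'I_A} *
  {ffun {ffun 'I_n -> J} -> 'I_B} * {ffun {ffun 'I_n -> K} -> 'I_C})%type.

(** Each [w] acts componentwise on pairs of index sequences, so the images of the power stay inside
    the matrix multiplication support; the covering hypothesis makes them exhaust it, and support
    rank is subadditive under unions. *)
Lemma Rs_mm_cover (R : realType) (Q : {ffun 'I_n -> I * J * K} -> R)
    (s : seq maps) :
  (forall t, Q t != 0 -> forall i, t i \in Lam) ->
  (forall c, has (fun w => covers seqI seqJ seqK Q w c) s) ->
  (Rs F (mm_supp A B C) <= size s * Rs F (supp_pow (brak Lam) n))%N.
Proof.
move=> QLam Hs.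
pose fst' (X Y : finType) (x : {ffun 'I_n -> X * Y}) := [ffun i => (x i).1].
pose snd' (X Y : finType) (x : {ffun 'I_n -> X * Y}) := [ffun i => (x i).2].
pose f (w : maps) (x : {ffun 'I_n -> I * J}) := (w.1.1 (fst' _ _ x), w.1.2 (snd' _ _ x)).
pose g (w : maps) (x : {ffun 'I_n -> J * K}) := (w.1.2 (fst' _ _ x), w.2 (snd' _ _ x)).
pose h (w : maps) (x : {ffun 'I_n -> K * I}) := (w.2 (fst' _ _ x), w.1.1 (snd' _ _ x)).
pose im (w : maps) := [set (f w t.1.1, g w t.1.2, h w t.2) | t in supp_pow (brak Lam) n].
suff -> : mm_supp A B C = \big[@finset.setU _/finset.set0]_(w <- s) im w.
  by apply: Rs_bigcup => // w; exact: Rs_image.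
have in_im t : (t \in \big[@finset.setU _/finset.set0]_(w <- s) im w) =
    has (fun w => t \in im w) s.
  elim: (s) => [|w s' IH]; first by rewrite big_nil inE.
  by rewrite big_cons inE IH.
apply/setP => t'; rewrite in_im; apply/idP/hasP.
  case: t' => [[[a b] [b' c]] [c' a']]; rewrite mem_brak /= inE andbT.
  move=> /and3P[/eqP<- /eqP<- /eqP->].
  have /hasP[w ws /existsP[t /and4P[/QLam tL /eqP E1 /eqP E2 /eqP E3]]] := Hs (a, b, c).
  exists w => //; apply/imsetP.
  exists ([ffun i => ((t i).1.1, (t i).1.2)], [ffun i => ((t i).1.2, (t i).2)],
          [ffun i => ((t i).2, (t i).1.1)]).
    rewrite inE; apply/forallP => i; rewrite mem_brak /= !ffunE /= !eqxx /=.
    by case: (t i) (tL i) => [[]].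
  rewrite /f /g /h /=; move: E1 E2 E3 => /= <- <- <-.
  by congr (_, _, (_, _), (_, _)); congr (_ _); apply/ffunP => i; rewrite !ffunE.
move=> [w _ /imsetP[[[x y] z]]]; rewrite inE => /forallP /= H ->.
rewrite mem_brak /= inE andbT.
have H' i : [&& (x i).2 == (y i).1, (y i).2 == (z i).1 & (z i).2 == (x i).1].
  by have := H i; rewrite mem_brak /= => /and4P[-> -> ->].
by apply/and3P; split; apply/eqP; congr (_ _); apply/ffunP => i; rewrite !ffunE;
  have /and3P[/eqP E1 /eqP E2 /eqP E3] := H' i.
Qed.

End MatrixMultiplicationImage.

(** The left side equals the term on the right that belongs to exactly the set of true flags; the
    other terms are nonnegative. *)
Lemma pattern_le (R : realDomainType) (q A B C : R) (eA eB eC : bool) :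
  0 <= q -> 0 <= A -> 0 <= B -> 0 <= C ->
  q * (A ^+ eA * B ^+ eB * C ^+ eC) <=
  q + A * (q * eA%:R) + B * (q * eB%:R) + C * (q * eC%:R) + A * B * (q * (eA && eB)%:R) +
  A * C * (q * (eA && eC)%:R) + B * C * (q * (eB && eC)%:R) +
  A * B * C * (q * [&& eA, eB & eC]%:R).
Proof.
move=> q0 A0 B0 C0.
have qA := mulr_ge0 q0 A0; have qB := mulr_ge0 q0 B0; have qC := mulr_ge0 q0 C0.
have qAB := mulr_ge0 qA B0; have qAC := mulr_ge0 qA C0; have qBC := mulr_ge0 qB C0.
have qABC := mulr_ge0 qAB C0.
by case: eA; case: eB; case: eC; rewrite /= ?expr1 ?expr0 ?mulr1 ?mulr0 ?addr0; lra.
Qed.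

Lemma sum_negb_andb (R : realType) (T : finType) (p : T -> R) (A B : pred T) :
  (forall t, 0 <= p t) ->
  \sum_(t | ~~ (A t && B t)) p t <= \sum_(t | ~~ A t) p t + \sum_(t | ~~ B t) p t.
Proof.
move=> p0; rewrite [leLHS]big_mkcond [in leRHS]big_mkcond.
rewrite [X in _ <= _ + X]big_mkcond -big_split /=; apply: ler_sum => t _.
by have := p0 t; case: (A t); case: (B t) => /=; lra.
Qed.

(** * Collision sums under the entropy conditions *)

Section MainInequality.
Local Open Scope classical_set_scope.
Variables (R : realType) (I J K : finType) (P : I * J * K -> R).
Hypotheses (P_ge0 : forall t, 0 <= P t) (P_sum : \sum_t P t = 1).

Definition prI (t : I * J * K) := t.1.1.
Definition prJ (t : I * J * K) := t.1.2.
Definition prK (t : I * J * K) := t.2.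
Definition prIJ (t : I * J * K) := (t.1.1, t.1.2).
Definition prIK (t : I * J * K) := (t.1.1, t.2).
Definition prJK (t : I * J * K) := (t.1.2, t.2).

Definition all_typical d n (t : {ffun 'I_n -> I * J * K}) : bool :=
  [&& typical P prI d t, typical P prJ d t, typical P prK d t, typical P prIJ d t,
      typical P prIK d t, typical P prJK d t & typical P id d t].

(** Left unnormalised, so that it stays pointwise below [iid P]. *)
Definition trunc_iid d n (t : {ffun 'I_n -> I * J * K}) : R :=
  iid P t * (all_typical d t)%:R.

Lemma near_trunc_iid d : 0 < d ->
  \forall n \near \oo, 2^-1 <= \sum_(t : {ffun 'I_n -> I * J * K}) trunc_iid d t.
Proof.
(* Seven typicality conditions, each failing with probability at most 1/14, together fail with
   probability at most 1/2. *)
move=> d0; have e0 : (0 : R) < 14^-1 by rewrite invr_gt0.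
have near_t (S : finType) (pi : I * J * K -> S) := near_typical P_ge0 P_sum pi d0 e0.
near=> n.
have : \sum_(t : {ffun 'I_n -> I * J * K} | ~~ all_typical d t) iid P t <=
    14^-1 + (14^-1 + (14^-1 + (14^-1 + (14^-1 + (14^-1 + 14^-1))))).
  have p0 (t : {ffun 'I_n -> I * J * K}) := iid_ge0 P_ge0 t.
  do 6!(apply: le_trans (sum_negb_andb _ _ p0) _; apply: lerD; first by near: n; exact: near_t).
  by near: n; exact: near_t.
have : \sum_(t : {ffun 'I_n -> I * J * K}) trunc_iid d t +
    \sum_(t : {ffun 'I_n -> I * J * K} | ~~ all_typical d t) iid P t = 1.
  rewrite -(sum_iid P_sum n) [X in _ + X]big_mkcond -big_split /=; apply: eq_bigr => t _.
  by rewrite /trunc_iid; case: all_typical => /=; ring.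
by lra.
Unshelve. all: by end_near.
Qed.

Variables (a b c d : R) (n : nat).
Hypotheses (a0 : 0 <= a) (b0 : 0 <= b) (c0 : 0 <= c).
Hypotheses (aI : a <= entropy (marg prI P)) (bJ : b <= entropy (marg prJ P))
  (cK : c <= entropy (marg prK P)) (abIJ : a + b <= entropy (marg prIJ P))
  (acIK : a + c <= entropy (marg prIK P)) (bcJK : b + c <= entropy (marg prJK P))
  (abcIJK : a + b + c <= entropy P).

Local Notation seqs := {ffun 'I_n -> I * J * K}.
Local Notation Q := (@trunc_iid d n).
Let A : R := (fl2 (a * n%:R))%:R.
Let B : R := (fl2 (b * n%:R))%:R.
Let C : R := (fl2 (c * n%:R))%:R.

Lemma trunc_iid_ge0 (t : seqs) : 0 <= Q t.
Proof. by rewrite mulr_ge0 ?iid_ge0. Qed.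

Lemma trunc_iid_le (t : seqs) : Q t <= iid P t.
Proof. by rewrite /trunc_iid; case: all_typical; rewrite ?mulr1 // mulr0 iid_ge0. Qed.

Lemma trunc_iid_typical (t : seqs) : Q t != 0 -> all_typical d t.
Proof. by apply: contraNT; rewrite /trunc_iid => /negbTE ->; rewrite mulr0. Qed.

(** The collision probability is at most [2 ^ (- n (H - d))], where [H] is the entropy of the
    projection, so a factor [M <= 2 ^ (x n)] with [x <= H] leaves at most [2 ^ (d n)]. *)
Lemma collision_term (S : finType) (pi : I * J * K -> S) M x :
  (forall t : seqs, all_typical d t -> typical P pi d t) ->
  0 <= M -> M <= 2 `^ (x * n%:R) -> x <= entropy (marg pi P) ->
  M * \sum_(p : seqs * seqs) Q p.1 * Q p.2 * [forall i, pi (p.1 i) == pi (p.2 i)]%:R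
    <= 2 `^ (d * n%:R).
Proof.
move=> typ M0 Mx xH.
rewrite -(pair_bigA _ (fun t t' : seqs => Q t * Q t' *
  [forall i, pi (t i) == pi (t' i)]%:R)) /=.
have H := collision_le P_sum trunc_iid_ge0 trunc_iid_le
  (fun t Qt => typ t (trunc_iid_typical Qt)).
apply: le_trans (ler_pM _ _ Mx H) _.
- exact: M0.
- apply: sumr_ge0 => t _; apply: sumr_ge0 => t' _.
  exact: mulr_ge0 (mulr_ge0 (trunc_iid_ge0 t) (trunc_iid_ge0 t')) (ler0n _ _).
rewrite -powRD ?pnatr_eq0 ?implybT // ler_powR ?ler1n //.
have : 0 <= (entropy (marg pi P) - x) * n%:R by rewrite mulr_ge0 // subr_ge0.
lra.
Qed.

(** The bound is a sum over the sets of components on which two sequences agree. The seven nonempty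
    sets use the seven entropy conditions, the empty one the total mass; each contributes at most
    [2 ^ (d n)]. *)
Lemma collision_sum_le : 0 < d ->
  \sum_t \sum_t' Q t * Q t' * (A ^+ (seqI t == seqI t') * B ^+ (seqJ t == seqJ t') *
    C ^+ (seqK t == seqK t')) <= 8 * 2 `^ (d * n%:R).
Proof.
move=> d0; rewrite pair_bigA /=.
pose e (S : finType) (pi : I * J * K -> S) (p : seqs * seqs) : R :=
  [forall i, pi (p.1 i) == pi (p.2 i)]%:R.
have A0 : 0 <= A := ler0n _ _; have B0 : 0 <= B := ler0n _ _; have C0 : 0 <= C := ler0n _ _.
have Ale : A <= 2 `^ (a * n%:R) := fl2_le _.
have Ble : B <= 2 `^ (b * n%:R) := fl2_le _.
have Cle : C <= 2 `^ (c * n%:R) := fl2_le _.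
have pow0 x : 0 <= 2 `^ x :> R := powR_ge0 _ _.
have powD x y : 2 `^ (x * n%:R) * 2 `^ (y * n%:R) = 2 `^ ((x + y) * n%:R) :> R.
  by rewrite mulrDl powRD // pnatr_eq0 implybT.
have ABle : A * B <= 2 `^ ((a + b) * n%:R) by rewrite -powD ler_pM.
have ACle : A * C <= 2 `^ ((a + c) * n%:R) by rewrite -powD ler_pM.
have BCle : B * C <= 2 `^ ((b + c) * n%:R) by rewrite -powD ler_pM.
have ABCle : A * B * C <= 2 `^ ((a + b + c) * n%:R).
  by rewrite -powD ler_pM ?mulr_ge0.
have H : entropy (marg id P) = entropy P by rewrite marg_id.
have abc_id : a + b + c <= entropy (marg id P) by rewrite H.
pose Sm (S : finType) (pi : I * J * K -> S) := \sum_p Q p.1 * Q p.2 * e S pi p.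
have tI : A * Sm _ prI <= 2 `^ (d * n%:R).
  by apply: (collision_term _ A0 Ale aI) => t /and5P[].
have tJ : B * Sm _ prJ <= 2 `^ (d * n%:R).
  by apply: (collision_term _ B0 Ble bJ) => t /and5P[].
have tK : C * Sm _ prK <= 2 `^ (d * n%:R).
  by apply: (collision_term _ C0 Cle cK) => t /and5P[].
have tIJ : A * B * Sm _ prIJ <= 2 `^ (d * n%:R).
  by apply: (collision_term _ (mulr_ge0 A0 B0) ABle abIJ) => t /and5P[].
have tIK : A * C * Sm _ prIK <= 2 `^ (d * n%:R).
  by apply: (collision_term _ (mulr_ge0 A0 C0) ACle acIK) => t /and5P[_ _ _ _ /and3P[]].
have tJK : B * C * Sm _ prJK <= 2 `^ (d * n%:R).
  by apply: (collision_term _ (mulr_ge0 B0 C0) BCle bcJK) => t /and5P[_ _ _ _ /and3P[]].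
have tIJK : A * B * C * Sm _ id <= 2 `^ (d * n%:R).
  by apply: (collision_term _ (mulr_ge0 (mulr_ge0 A0 B0) C0) ABCle abc_id)
    => t /and5P[_ _ _ _ /and3P[]].
have t0 : \sum_(p : seqs * seqs) Q p.1 * Q p.2 <= 2 `^ (d * n%:R).
  rewrite -(pair_bigA _ (fun t t' : seqs => Q t * Q t')) /= -big_distrlr /=.
  have Q1 : \sum_t Q t <= 1.
    by rewrite -(sum_iid P_sum n); apply: ler_sum => t _; exact: trunc_iid_le.
  rewrite (@le_trans _ _ (1 * 1)) // ?ler_pM ?sumr_ge0 // => [t _|t _|].
  - exact: trunc_iid_ge0.
  - exact: trunc_iid_ge0.
  - by rewrite mulr1 -[leLHS](powRr0 2) ler_powR ?ler1n // mulr_ge0 // ltW.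
apply: (@le_trans _ _ (\sum_(p : seqs * seqs) Q p.1 * Q p.2 +
  A * Sm _ prI + B * Sm _ prJ + C * Sm _ prK + A * B * Sm _ prIJ + A * C * Sm _ prIK +
  B * C * Sm _ prJK + A * B * C * Sm _ id)); last by lra.
rewrite /Sm !mulr_sumr -!big_split /=; apply: ler_sum => -[t t'] _ /=.
have eI : (seqI t == seqI t') = [forall i, prI (t i) == prI (t' i)].
  apply/eqP/forallP => [/ffunP E i|E]; first by have := E i; rewrite !ffunE => /eqP.
  by apply/ffunP => i; rewrite !ffunE; exact: (eqP (E i)).
have eJ : (seqJ t == seqJ t') = [forall i, prJ (t i) == prJ (t' i)].
  apply/eqP/forallP => [/ffunP E i|E]; first by have := E i; rewrite !ffunE => /eqP.
  by apply/ffunP => i; rewrite !ffunE; exact: (eqP (E i)).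
have eK : (seqK t == seqK t') = [forall i, prK (t i) == prK (t' i)].
  apply/eqP/forallP => [/ffunP E i|E]; first by have := E i; rewrite !ffunE => /eqP.
  by apply/ffunP => i; rewrite !ffunE; exact: (eqP (E i)).
have forall_and (p q : pred 'I_n) :
    [forall i, p i && q i] = [forall i, p i] && [forall i, q i].
  apply/forallP/andP => [E|[/forallP E /forallP E'] i]; last by rewrite E E'.
  by split; apply/forallP => i; have /andP[] := E i.
have eIJ : [forall i, prIJ (t i) == prIJ (t' i)] = (seqI t == seqI t') && (seqJ t == seqJ t').
  by rewrite eI eJ -forall_and.
have eIK : [forall i, prIK (t i) == prIK (t' i)] = (seqI t == seqI t') && (seqK t == seqK t').
  by rewrite eI eK -forall_and.
have eJK : [forall i, prJK (t i) == prJK (t' i)] = (seqJ t == seqJ t') && (seqK t == seqK t').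
  by rewrite eJ eK -forall_and.
have eIJK : [forall i, id (t i) == id (t' i)] =
    [&& seqI t == seqI t', seqJ t == seqJ t' & seqK t == seqK t'].
  rewrite eI eJ eK -!forall_and; apply: eq_forallb => i.
  by rewrite /prI /prJ /prK; case: (t i) (t' i) => [[? ?] ?] [[? ?] ?] /=; rewrite !xpair_eqE andbA.
rewrite /e eIJ eIK eJK eIJK -eI -eJ -eK.
apply: pattern_le => //; exact: mulr_ge0 (trunc_iid_ge0 t) (trunc_iid_ge0 t').
Qed.

End MainInequality.

(** * The bound for rectangular matrix multiplication *)

Section MatrixMultiplicationBound.
Local Open Scope classical_set_scope.
Variables (R : realType) (F : fieldType) (I J K : finType) (Lam : {set I * J * K}).
Hypothesis Finf : infinite_field F.
Variables (P : I * J * K -> R) (a b c : R).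
Hypotheses (P_Lam : is_distr_on Lam P) (a0 : 0 <= a) (b0 : 0 <= b) (c0 : 0 <= c).
Hypotheses (aI : a <= entropy (marg (@prI I J K) P))
  (bJ : b <= entropy (marg (@prJ I J K) P))
  (cK : c <= entropy (marg (@prK I J K) P))
  (abIJ : a + b <= entropy (marg (@prIJ I J K) P))
  (acIK : a + c <= entropy (marg (@prIK I J K) P))
  (bcJK : b + c <= entropy (marg (@prJK I J K) P))
  (abcIJK : a + b + c <= entropy P).

Lemma distr_neq0 : Lam != finset.set0.
Proof.
case: P_Lam => _ [PLam P1]; apply/eqP => L0.
have : \sum_t P t = 0 by apply: big1 => t _; apply: PLam; rewrite L0 inE.
by rewrite P1 => /eqP; rewrite oner_eq0.
Qed.

Lemma near_Rs_mm d : 0 < d -> \forall n \near \oo, exists m : nat,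
  m%:R <= 32 * ((a + b + c) * n%:R * ln 2) * 2 `^ (d * n%:R) + 1 /\
  (Rs F (mm_supp (fl2 (a * n%:R)) (fl2 (b * n%:R)) (fl2 (c * n%:R)))
    <= m * Rs F (supp_pow (brak Lam) n))%N.
Proof.
move=> d0; case: P_Lam => P0 [PLam P1].
near=> n.
have Qmass : 2^-1 <= \sum_(t : {ffun 'I_n -> I * J * K}) trunc_iid P d t.
  by near: n; exact: near_trunc_iid.
pose A := fl2 (a * n%:R); pose B := fl2 (b * n%:R); pose C := fl2 (c * n%:R).
pose Q := @trunc_iid R I J K P d n.
(* Here 32 is 8 from the collision sum times 4 from the squared mass, which is at least 1/4. *)
pose eps : R := (32 * 2 `^ (d * n%:R))^-1.
have dn0 : 0 <= d * n%:R by rewrite mulr_ge0 // ltW.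
have pow1 : (1 : R) <= 2 `^ (d * n%:R) by rewrite -[leLHS](powRr0 2) ler_powR ?ler1n.
have eps0 : 0 < eps by rewrite invr_gt0 mulr_gt0 // powR_gt0.
have eps1 : eps <= 1 by rewrite invf_le1 ?mulr_gt0 ?powR_gt0 //; lra.
have k0 : 0 < 8 * 2 `^ (d * n%:R) :> R by rewrite mulr_gt0 // powR_gt0.
have Hk := collision_sum_le P0 P1 n aI bJ cK abIJ acIK bcJK abcIJK d0.
have Hcov x := cover_fraction x k0 Hk.
have Hcov' (x : 'I_A * 'I_B * 'I_C) : eps *
    #|{: ({ffun {ffun 'I_n -> I} -> 'I_A} * {ffun {ffun 'I_n -> J} -> 'I_B} *
    {ffun {ffun 'I_n -> K} -> 'I_C})%type}|%:R <=
    #|finset (fun w => covers (@seqI I J K n) (@seqJ I J K n) (@seqK I J K n) Q w x)|%:R.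
  have := Hcov x; apply: le_trans; apply: ler_wpM2r => //.
  rewrite ler_pdivlMr // /eps.
  have -> : (32 * 2 `^ (d * n%:R))^-1 * (8 * 2 `^ (d * n%:R)) = 2^-1 ^+ 2 :> R.
    by field; rewrite gt_eqF // powR_gt0.
  by rewrite lerXn2r // ?nnegrE // (le_trans _ Qmass).
have pos (x : R) : 0 <= x -> (0 < fl2 (x * n%:R))%N by move=> x0; rewrite fl2_gt0 // mulr_ge0.
pose o0 : ({ffun {ffun 'I_n -> I} -> 'I_A} * {ffun {ffun 'I_n -> J} -> 'I_B} *
    {ffun {ffun 'I_n -> K} -> 'I_C})%type :=
  ([ffun=> Ordinal (pos a a0)], [ffun=> Ordinal (pos b b0)], [ffun=> Ordinal (pos c c0)]).
pose h : R := (a + b + c) * n%:R * ln 2.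
have h0 : 0 <= h by rewrite !mulr_ge0 ?addr_ge0 // ltW // ln2_gt0.
have Th : #|{: 'I_A * 'I_B * 'I_C}|%:R <= expR h.
  rewrite !card_prod !card_ord !natrM /h !mulrDl !expRD.
  have E x : expR (x * n%:R * ln 2) = 2 `^ (x * n%:R) :> R by rewrite /powR pnatr_eq0.
  by rewrite !E !ler_pM ?mulr_ge0 // ?fl2_le.
have [s [sm Hs]] := greedy_cover_all o0 eps0 eps1 h0 Th Hcov'.
exists (size s); split.
  by apply: le_trans sm _; rewrite /eps invrK mulrCA mulrA.
apply: (Rs_mm_cover Finf (Q := Q)) Hs => t Qt i.
apply: contraNT Qt => /PLam Pt; rewrite /Q /trunc_iid /iid (bigD1 i) //= Pt.
by rewrite !mul0r.
Unshelve. all: by end_near.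
Qed.

Lemma mm_log_bound d : 0 < d -> exists C, \forall n \near \oo,
  mm_log F a b c n <= log2 (Rs F (supp_pow (brak Lam) n))%:R + (C + d * n%:R).
Proof.
(* One half of [d] is spent on the size of the covering family, the other on absorbing
   [log2 n.+1]. *)
move=> d0; have d2 : 0 < d / 2 by rewrite divr_gt0.
have [C HC] := log2_sublinear d2.
pose D : R := 32 * ((a + b + c) * ln 2) + 1.
have D0 : 0 < D.
  by rewrite ltr_wpDl // mulr_ge0 // mulr_ge0 ?addr_ge0 // ltW // ln2_gt0.
exists (log2 D + C); near=> n.
have [m [Hm Rm]] : exists m : nat,
  m%:R <= 32 * ((a + b + c) * n%:R * ln 2) * 2 `^ (d / 2 * n%:R) + 1 /\
  (Rs F (mm_supp (fl2 (a * n%:R)) (fl2 (b * n%:R)) (fl2 (c * n%:R)))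
    <= m * Rs F (supp_pow (brak Lam) n))%N.
  by near: n; exact: near_Rs_mm.
have R0 : (0 < Rs F (mm_supp (fl2 (a * n%:R)) (fl2 (b * n%:R)) (fl2 (c * n%:R))))%N.
  by rewrite Rs_fl2_gt0 // mulr_ge0.
have S0 : (0 < Rs F (supp_pow (brak Lam) n))%N.
  rewrite Rs_gt0 // supp_pow_neq0 //; have /set0Pn[t tL] := distr_neq0.
  by apply/set0Pn; eexists; apply: (imset_f _ tL).
have m0 : (0 < m)%N by case: (m) Rm R0 => //; rewrite mul0n leqn0 => /eqP ->.
rewrite /mm_log (@le_trans _ _ (log2 (m * Rs F (supp_pow (brak Lam) n))%:R)) //.
  by rewrite ler_log2 ?ltr0n // ler_nat.
rewrite natrM log2M ?ltr0n // addrC lerD2l.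
have : log2 (m%:R : R) <= log2 (D * n.+1%:R * 2 `^ (d / 2 * n%:R)).
  rewrite ler_log2 ?ltr0n // (le_trans Hm) //.
  have pow1 : (1 : R) <= 2 `^ (d / 2 * n%:R).
    by rewrite -[leLHS](powRr0 2) ler_powR ?ler1n // mulr_ge0 // ltW.
  have x0 : 0 <= 32 * ((a + b + c) * ln 2).
    by rewrite mulr_ge0 // mulr_ge0 ?addr_ge0 // ltW // ln2_gt0.
  rewrite -(natr1 n) /D; have n0 : (0 : R) <= n%:R by [].
  rewrite (_ : 32 * ((a + b + c) * n%:R * ln 2) = 32 * ((a + b + c) * ln 2) * n%:R); last by ring.
  by move: x0; move: (32 * _) => x x0; nra.
rewrite !log2M ?mulr_gt0 ?powR_gt0 ?ltr0n // log2_powR.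
have := HC n; lra.
Unshelve. all: by end_near.
Qed.

Lemma omega_s_le_aRs : omega_s F a b c <= log2 (aRs R F (brak Lam)).
Proof.
have [cvg_omega _] := omega_s_cvg Finf a0 b0 c0.
apply: le_lim_sublinear cvg_omega _ mm_log_bound.
apply: aRs_cvg => //; have /set0Pn[t tL] := distr_neq0.
by apply/set0Pn; eexists; apply: (imset_f _ tL).
Qed.

End MatrixMultiplicationBound.

(** * Entropy inequalities *)

Section EntropyInequalities.
Variables (R : realType) (T : finType) (P : T -> R).
Hypotheses (P_ge0 : forall x, 0 <= P x) (P_sum : \sum_x P x = 1).
Local Notation H f := (entropy (marg f P)).

(** When [g] determines [f], each fibre of [g] lies in a fibre of [f] and so has at most its
    probability. *)
Lemma entropy_marg_mono (S S' : finType) (f : T -> S) (g : T -> S') :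
  (forall x y, g x = g y -> f x = f y) -> H f <= H g.
Proof.
move=> gf; rewrite !entropy_margE lerN2; apply: ler_sum => x _.
have [->|Px] := eqVneq (P x) 0; first by rewrite !mul0r.
rewrite ler_wpM2l // ler_log2 ?marg_gt0 // /marg [leLHS]big_mkcond [leRHS]big_mkcond.
by apply: ler_sum => y _; case: eqP => [/gf ->|_]; [rewrite eqxx | case: ifP].
Qed.

Lemma entropy_marg_eq (S S' : finType) (f : T -> S) (g : T -> S') :
  (forall x y, g x = g y <-> f x = f y) -> H f = H g.
Proof.
by move=> gf; apply/eqP; rewrite eq_le !entropy_marg_mono // => x y; have [] := gf x y.
Qed.

Lemma entropy_const : H (fun=> tt) = 0.
Proof.
rewrite entropy_margE big1 ?oppr0 // => x _.
rewrite /marg (eq_bigl xpredT) => [|y]; last by rewrite eqxx.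
by rewrite P_sum /log2 ln1 mul0r mulr0.
Qed.

Lemma entropy_marg_ge0 (S : finType) (f : T -> S) : 0 <= H f.
Proof. by rewrite -entropy_const; exact: entropy_marg_mono. Qed.

Lemma sum_marg_pair (A C : finType) (f : T -> A) (g : T -> C) c :
  \sum_a marg (fun x => (f x, g x)) P (a, c) = marg g P c.
Proof.
rewrite /marg [RHS](partition_big f predT) //=; apply: eq_bigr => a _.
by apply: eq_bigl => x; rewrite xpair_eqE andbC.
Qed.

Lemma ln_le_subr1 (y : R) : 0 < y -> ln y <= y - 1.
Proof. by move=> y0; have := expR_ge1Dx (ln y); rewrite lnK //; lra. Qed.

(** This is the nonnegativity of the conditional mutual information of [f] and [g] given [h]: the
    ratio [G] has mean at most 1, and [ln y <= y - 1] bounds its mean logarithm by 0. *)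
Lemma entropy_submodular (A B C : finType) (f : T -> A) (g : T -> B) (h : T -> C) :
  H (fun x => (f x, g x, h x)) + H h <= H (fun x => (f x, h x)) + H (fun x => (g x, h x)).
Proof.
set fgh := fun x => (f x, g x, h x); set fh := fun x => (f x, h x).
set gh := fun x => (g x, h x).
pose G (s : A * B * C) := marg fh P (s.1.1, s.2) * marg gh P (s.1.2, s.2) /
  (marg fgh P s * marg h P s.2).
have mge0 (S : finType) (k : T -> S) s : 0 <= marg k P s := marg_ge0 P_ge0 k s.
have G1 : \sum_x P x * G (fgh x) <= 1.
  rewrite -marg_sum.
  apply: (@le_trans _ _ (\sum_(s : A * B * C) marg fh P (s.1.1, s.2) *
      marg gh P (s.1.2, s.2) / marg h P s.2)).
    (* Where the joint marginal vanishes the left term is 0 while the right one may be positive,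
       hence only an inequality. *)
    apply: ler_sum => s _; rewrite /G; have [->|s0] := eqVneq (marg fgh P s) 0.
      by rewrite mul0r divr_ge0 ?mulr_ge0.
    by rewrite invfM mulrCA mulVKf.
  rewrite -(pair_bigA _ (fun p c => marg fh P (p.1, c) * marg gh P (p.2, c) / marg h P c)).
  rewrite exchange_big /= -[leRHS]P_sum.
  have <- : \sum_c marg h P c = \sum_x P x.
    under eq_bigr do rewrite -[marg h P _]mulr1.
    by rewrite marg_sum; under eq_bigr do rewrite mulr1.
  apply: ler_sum => c _.
  rewrite -mulr_suml -(pair_bigA _ (fun a b => marg fh P (a, c) * marg gh P (b, c))) /=.
  rewrite -big_distrlr /= !sum_marg_pair.
  by have [->|c0] := eqVneq (marg h P c) 0; rewrite ?mul0r // mulfK.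
have : \sum_x P x * (G (fgh x) - 1) <= 0.
  under eq_bigr do rewrite mulrBr mulr1.
  by rewrite sumrB P_sum subr_le0.
move=> G0; rewrite !entropy_margE -!opprD lerN2 -!big_split /=.
rewrite -subr_le0 -sumrB -(pmulr_lle0 _ (ln2_gt0 R)) mulr_suml.
apply: le_trans G0; apply: ler_sum => x _.
have [->|Px] := eqVneq (P x) 0; first by rewrite !mul0r addr0 subr0 mul0r.
have p1 : 0 < marg fh P (fh x) := marg_gt0 P_ge0 fh Px.
have p2 : 0 < marg gh P (gh x) := marg_gt0 P_ge0 gh Px.
have p3 : 0 < marg fgh P (fgh x) := marg_gt0 P_ge0 fgh Px.
have p4 : 0 < marg h P (h x) := marg_gt0 P_ge0 h Px.
have := ln_le_subr1 (divr_gt0 (mulr_gt0 p1 p2) (mulr_gt0 p3 p4)).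
rewrite ln_div ?posrE ?mulr_gt0 // !lnM ?posrE // => lnG.
rewrite -!mulrDr -mulrBr -mulrA ler_wpM2l // (le_trans _ lnG) // /log2.
rewrite -!mulrDl -mulrBl divfK ?gt_eqF ?ln2_gt0 //.
Qed.

(** Submodularity with a constant third variable. *)
Lemma entropy_subadditive (A B : finType) (f : T -> A) (g : T -> B) :
  H (fun x => (f x, g x)) <= H f + H g.
Proof.
have := entropy_submodular f g (fun=> tt); rewrite entropy_const addr0.
rewrite (@entropy_marg_eq _ _ (fun x => (f x, g x, tt)) (fun x => (f x, g x))).
  rewrite (@entropy_marg_eq _ _ (fun x => (f x, tt)) f) => [|x y]; last first.
    by split=> [->//|[]].
  by rewrite (@entropy_marg_eq _ _ (fun x => (g x, tt)) g) => [|x y]; last by split=> [->//|[]].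
by move=> x y; split=> [[-> ->]|[-> ->]].
Qed.

End EntropyInequalities.

Lemma entropy_uniform (R : realType) (T : finType) (L : {set T}) : (0 < #|L|)%N ->
  entropy (fun t => (t \in L)%:R / #|L|%:R : R) = log2 #|L|%:R.
Proof.
move=> L0; have LR : (0 : R) < #|L|%:R by rewrite ltr0n.
rewrite /entropy (eq_bigr (fun t => if t \in L then #|L|%:R^-1 * log2 (#|L|%:R^-1 : R) else 0)).
  rewrite -big_mkcond sumr_const -[X in - X]mulr_natl mulrA divff ?gt_eqF // mul1r.
  by rewrite /log2 lnV // mulNr opprK.
by move=> t _; case: (t \in L); rewrite ?mul1r ?mul0r.
Qed.

(** * Conclusion *)

Section Conclusion.
Local Open Scope classical_set_scope.
Variables (R : realType) (F : fieldType).
Hypothesis Finf : infinite_field F.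

Lemma bRs_gt0 (X Y Z : finType) (Phi : {set X * Y * Z}) :
  Phi != finset.set0 -> (0 < bRs F Phi)%N.
Proof.
move=> Phi0; have := Rs_supp_pow_le Finf Phi 1.
rewrite expn1; case: (bRs F Phi) => //; rewrite muln0 leqn0 => /eqP E.
by have := Rs_gt0 F (supp_pow_neq0 1 Phi0); rewrite E.
Qed.

(** The factor polynomial in [n] in the bound on the support rank of powers is negligible after
    taking [n]-th roots. *)
Lemma log2_aRs_le (X Y Z : finType) (Phi : {set X * Y * Z}) : Phi != finset.set0 ->
  log2 (aRs R F Phi) <= log2 (bRs F Phi)%:R.
Proof.
move=> Phi0; have bR : (0 : R) < (bRs F Phi)%:R by rewrite ltr0n bRs_gt0.
apply: (@le_lim_sublinear R (fun n => log2 (Rs F (supp_pow Phi n))%:R)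
  (fun n => n%:R * log2 (bRs F Phi)%:R)); first exact: aRs_cvg.
  apply: cvg_near_cst; near=> n; rewrite mulKf // pnatr_eq0 -lt0n.
  by near: n; exact: nbhs_infty_gt.
move=> d d0; pose D : R := #|{: X * Y * Z}|%:R + 1.
have D0 : 0 < D by rewrite ltr_wpDl.
have [C HC] := log2_sublinear (divr_gt0 d0 D0).
exists (D * C); near=> n.
apply: (@le_trans _ _ (log2 ((n.+1 ^ #|{: X * Y * Z}| * bRs F Phi ^ n)%:R))).
  by rewrite ler_log2 ?ltr0n ?Rs_gt0 ?supp_pow_neq0 // ler_nat; exact: Rs_supp_pow_le.
rewrite natrM log2M ?ltr0n ?expn_gt0 ?bRs_gt0 // !log2_natX addrC lerD2l.
apply: (@le_trans _ _ (D * log2 n.+1%:R)).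
  by rewrite ler_wpM2r ?log2_ge0_nat // lerDl.
rewrite (le_trans (ler_wpM2l (ltW D0) (HC n))) // mulrDr mulrA mulrCA divff ?mulr1 //.
by rewrite gt_eqF.
Unshelve. all: by end_near.
Qed.

Lemma omega_s_ge0 (a b c : R) : 0 <= a -> 0 <= b -> 0 <= c -> 0 <= omega_s F a b c.
Proof.
move=> a0 b0 c0; have [cl _] := omega_s_cvg Finf a0 b0 c0.
apply: ler_cvg_to (cvg_cst 0) cl _; apply: nearW => n.
by rewrite mulr_ge0 ?invr_ge0 // log2_ge0_nat.
Qed.

(** The product of the three cyclic rotations of [<A,B,C>] is a cube of side [ABC], and [<8,8,8>]
    supplies the margin for rounding. *)
Lemma Rs_mm_cube A B C M : (M <= 8 * (A * (B * C)))%N ->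
  (Rs F (mm_supp M M M) <= Rs F (mm_supp 8 8 8) * Rs F (mm_supp A B C) ^ 3)%N.
Proof.
move=> MABC.
have H : (Rs F (mm_supp M M M) <= Rs F (brak
    [set: ('I_8 * ('I_A * ('I_B * 'I_C))) * ('I_8 * ('I_B * ('I_C * 'I_A))) *
          ('I_8 * ('I_C * ('I_A * 'I_B)))]%SET))%N.
  apply: Rs_mm_supp => //; rewrite !card_prod !card_ord (leq_trans MABC) //.
    by rewrite leq_mul2l /= mulnCA leq_mul2l (mulnC A) leqnn !orbT.
  by rewrite leq_mul2l /= mulnA mulnC leqnn.
apply: leq_trans H _; apply: leq_trans (Rs_brak_prod Finf _ _ _ _ _ _) _.
rewrite leq_mul2l; apply/orP; right.
apply: leq_trans (Rs_brak_prod Finf _ _ _ _ _ _) _; rewrite expnS leq_mul2l; apply/orP; right.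
apply: leq_trans (Rs_brak_prod Finf _ _ _ _ _ _) _; rewrite expnS expn1.
have cyc := Rs_brak_cyc F 'I_A 'I_B 'I_C.
by apply: leq_mul => //; apply: leq_trans cyc; exact: Rs_brak_cyc.
Qed.

(** A cube of side about [2 ^ (h n)] is bounded by the three rotations of the format of [(a, b, c)]
    at [n]; growth rates in [n] are then compared. *)
Lemma omega_s_symmetrize (a b c : R) : 0 <= a -> 0 <= b -> 0 <= c ->
  (a + b + c) * omega_s F (1 : R) 1 1 <= 3 * omega_s F a b c.
Proof.
move=> a0 b0 c0; set h := a + b + c; set om := omega_s F (1 : R) 1 1.
have h0 : 0 <= h by rewrite !addr_ge0.
have om0 : 0 <= om by apply: omega_s_ge0.
have [_ [C HC]] := omega_s_cvg Finf (@ler01 R) ler01 ler01.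
have [cl _] := omega_s_cvg Finf a0 b0 c0.
apply: (le_lim_sublinear (u := fun n => n%:R * (h * om))
  (w := fun n => 3 * mm_log F a b c n)).
- apply: cvg_near_cst; near=> n; rewrite mulKf // pnatr_eq0 -lt0n.
  by near: n; exact: nbhs_infty_gt.
- rewrite (_ : (fun n => _) = fun n => 3 * (n%:R^-1 * mm_log F a b c n)).
    exact: cvgMr.
  by apply/funext => n; rewrite mulrCA.
move=> d d0; exists (C + om + log2 (Rs F (mm_supp 8 8 8))%:R); near=> n.
(* Rounding [h n] down to an index [m] costs at most [om], which goes into the constant; the three
   floors at [n] cost the factor 8. *)
pose m := Num.truncn (h * n%:R).
have hn0 : 0 <= h * n%:R by rewrite mulr_ge0.
have m_le : m%:R <= h * n%:R by rewrite /m truncn_le.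
have m_gt : h * n%:R < m%:R + 1 by rewrite natr1 /m truncnS_gt.
have cube : mm_log F 1 1 1 m <= log2 (Rs F (mm_supp 8 8 8))%:R + 3 * mm_log F a b c n.
  rewrite /mm_log !mul1r -log2_natX -log2M ?ltr0n ?expn_gt0 ?Rs_fl2_gt0 ?mulr_ge0 //;
    last by rewrite Rs_gt0 // mm_supp_neq0.
  rewrite -natrM ler_log2 ?ltr0n ?Rs_fl2_gt0 // ler_nat; apply: Rs_mm_cube.
  rewrite -(ler_nat R) (le_trans (fl2_le _)) // (le_trans (ler_powR _ m_le)) ?ler1n //.
  have pw x y : 2 `^ (x + y) = 2 `^ x * 2 `^ y :> R.
    by rewrite powRD // pnatr_eq0 implybT.
  rewrite /h !mulrDl !pw.
  have E x : 0 <= x -> (2 : R) `^ (x * n%:R) <= 2 * (fl2 (x * n%:R))%:R.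
    by move=> x0; apply: fl2_lt; rewrite mulr_ge0.
  apply: le_trans (ler_pM _ _ (ler_pM _ _ (E a a0) (E b b0)) (E c c0)) _;
    rewrite ?mulr_ge0 ?powR_ge0 // !natrM le_eqVlt; apply/orP; left; apply/eqP; ring.
have := HC m; rewrite -/om => HCm.
have : (h * n%:R) * om <= (m%:R + 1) * om by rewrite ler_wpM2r // ltW.
have : 0 <= d * n%:R by rewrite mulr_ge0 // ltW.
by move: HCm cube; rewrite /=; lra.
Unshelve. all: by end_near.
Qed.

End Conclusion.

Theorem theorem4p9 (R : realType) (F : fieldType) (I J K : finType)
  (Lam : {set I * J * K}) :
  infinite_field F -> Lam != finset.set0 ->
  (forall (P : I * J * K -> R) (a b c : R),
     is_distr_on Lam P -> 0 <= a -> 0 <= b -> 0 <= c ->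
     a <= entropy (marg (fun t : I * J * K => t.1.1) P) ->
     b <= entropy (marg (fun t : I * J * K => t.1.2) P) ->
     c <= entropy (marg (fun t : I * J * K => t.2) P) ->
     a + b <= entropy (marg (fun t : I * J * K => (t.1.1, t.1.2)) P) ->
     a + c <= entropy (marg (fun t : I * J * K => (t.1.1, t.2)) P) ->
     b + c <= entropy (marg (fun t : I * J * K => (t.1.2, t.2)) P) ->
     a + b + c <= entropy P ->
     omega_s F a b c <= log2 (aRs R F (brak Lam))
     /\ log2 (aRs R F (brak Lam)) <= log2 ((bRs F (brak Lam))%:R : R)
     /\ log2 ((bRs F (brak Lam))%:R : R) <= log2 ((Rs F (brak Lam))%:R : R)) /\
  ((1 < #|Lam|)%N ->
     omega_s F (1 : R) 1 1 <=
       3 * log2 ((Rs F (brak Lam))%:R : R) / log2 (#|Lam|%:R : R)).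
Proof.
move=> Finf Lam0.
have brak0 : brak Lam != finset.set0.
  by have /set0Pn[t tL] := Lam0; apply/set0Pn; eexists; apply: (imset_f _ tL).
have aRs_bRs := log2_aRs_le R Finf brak0.
have bRs_Rs : log2 ((bRs F (brak Lam))%:R : R) <= log2 ((Rs F (brak Lam))%:R : R).
  by rewrite ler_log2 ?ltr0n ?bRs_gt0 // ler_nat bRs_le_Rs.
have omega_le (P : I * J * K -> R) (a b c : R) :
     is_distr_on Lam P -> 0 <= a -> 0 <= b -> 0 <= c ->
     a <= entropy (marg (fun t : I * J * K => t.1.1) P) ->
     b <= entropy (marg (fun t : I * J * K => t.1.2) P) ->
     c <= entropy (marg (fun t : I * J * K => t.2) P) ->
     a + b <= entropy (marg (fun t : I * J * K => (t.1.1, t.1.2)) P) ->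
     a + c <= entropy (marg (fun t : I * J * K => (t.1.1, t.2)) P) ->
     b + c <= entropy (marg (fun t : I * J * K => (t.1.2, t.2)) P) ->
     a + b + c <= entropy P -> omega_s F a b c <= log2 (aRs R F (brak Lam)).
  by move=> *; apply: (@omega_s_le_aRs R F I J K Lam Finf P).
split=> [P a b c PL a0 b0 c0 aI bJ cK abIJ acIK bcJK abc|Lam1].
  by split; [exact: (omega_le P) | split].
have Lam_gt0 : (0 < #|Lam|)%N by exact: ltnW.
(* Its entropy is [log2 #|Lam|], the denominator of the claim. *)
pose P (t : I * J * K) : R := (t \in Lam)%:R / #|Lam|%:R.
have P0 t : 0 <= P t by rewrite divr_ge0.
have P1 : \sum_t P t = 1.
  rewrite /P -mulr_suml -natr_sum -big_mkcond /= sum1_card divff //.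
  by rewrite pnatr_eq0 -lt0n.
have PL : is_distr_on Lam P.
  by split=> //; split=> // t tL; rewrite /P (negbTE tL) mul0r.
pose H (S : finType) (f : I * J * K -> S) : R := entropy (marg f P).
pose fI (t : I * J * K) := t.1.1; pose fJ (t : I * J * K) := t.1.2.
pose fK (t : I * J * K) := t.2.
have HP : H _ id = entropy P by rewrite /H marg_id.
have IJ_I : H _ fI <= H _ (fun t => (fI t, fJ t)).
  by apply: entropy_marg_mono => // x y [].
have IJK_IJ : H _ (fun t => (fI t, fJ t)) <= H _ id.
  by apply: entropy_marg_mono => // x y ->.
have sub_IJ : H _ (fun t => (fI t, fJ t)) <= H _ fI + H _ fJ.
  exact: entropy_subadditive.
have sub_IJ_K : H _ id <= H _ (fun t => (fI t, fJ t)) + H _ fK.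
  apply: le_trans (entropy_subadditive P0 P1 _ _).
  by apply: entropy_marg_mono => // -[[? ?] ?] [[? ?] ?]; rewrite /fI /fJ /fK /= => -[-> -> ->].
have sub_I_JK : H _ id <= H _ fI + H _ (fun t => (fJ t, fK t)).
  apply: le_trans (entropy_subadditive P0 P1 _ _).
  by apply: entropy_marg_mono => // -[[? ?] ?] [[? ?] ?]; rewrite /fI /fJ /fK /= => -[-> -> ->].
(* For the choice below this is the condition [a + c <= H(IK)]; the conditions on [a], [a + b] and
   [a + b + c] hold there with equality. *)
have submod : H _ id + H _ fI <= H _ (fun t => (fI t, fJ t)) + H _ (fun t => (fI t, fK t)).
  rewrite (_ : H _ id = H _ (fun t => (fJ t, fK t, fI t))); last first.
    apply: entropy_marg_eq => // -[[? ?] ?] [[? ?] ?].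
    by rewrite /fI /fJ /fK /=; split=> [[-> -> ->]|[-> -> ->]].
  rewrite (_ : H _ (fun t => (fI t, fJ t)) = H _ (fun t => (fJ t, fI t))); last first.
    by apply: entropy_marg_eq => // x y; split=> [[-> ->]|[-> ->]].
  rewrite (_ : H _ (fun t => (fI t, fK t)) = H _ (fun t => (fK t, fI t))); last first.
    by apply: entropy_marg_eq => // x y; split=> [[-> ->]|[-> ->]].
  exact: entropy_submodular.
have HI0 : 0 <= H _ fI by exact: entropy_marg_ge0.
pose a := H _ fI; pose b := H _ (fun t => (fI t, fJ t)) - a.
pose c := H _ id - H _ (fun t => (fI t, fJ t)).
have abc_sum : a + b + c = H _ id by rewrite /b /c; ring.
have b0 : 0 <= b by rewrite subr_ge0.
have c0 : 0 <= c by rewrite subr_ge0.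
have omega_abc : omega_s F a b c <= log2 (aRs R F (brak Lam)).
  apply: (omega_le P) => //; rewrite -?[entropy (marg _ P)]/(H _ _).
  - by rewrite /b /a; move: sub_IJ; rewrite /fI /fJ; lra.
  - by rewrite /c; move: sub_IJ_K; rewrite /fI /fJ /fK; lra.
  - by rewrite /b /a; rewrite /fI /fJ; lra.
  - by rewrite /c /a; move: submod; rewrite /fI /fJ /fK; lra.
  - by rewrite /b /c /a; move: sub_I_JK; rewrite /fI /fJ /fK; lra.
  - by rewrite abc_sum HP.
have logL : 0 < log2 (#|Lam|%:R : R).
  by rewrite divr_gt0 ?ln2_gt0 // ln_gt0 // ltr1n.
rewrite ler_pdivlMr // mulrC -(entropy_uniform R Lam_gt0) -/P -HP -abc_sum.
apply: le_trans (omega_s_symmetrize Finf HI0 b0 c0) _.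
by rewrite ler_pM2l //; lra.
Qed.
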